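(* The $\exists$NE problem for coordination games $\mathcal{G}(G,w,C,\beta)$ with two colours and monochromatic queries $q$ can be solved in $\mathcal{O}(|G|)$ time using Algorithm A, the explicit procedure given in the context.
   Context: Coordination games. Fix a finite set of colours $M$, $m=|M|$. Let $G=(V,E)$ be a finite directed graph without self loops, $V=\{1,\dots,n\}$, $n>1$, $e=|E|$; $w$ assigns to each edge a nonnegative rational weight; $C:V\to 2^M\setminus\{\emptyset\}$ is a colour assignment; $\beta:V\times M\to\mathbb{Z}$ is a bonus function. In the game $\mathcal{G}(G,w,C,\beta)$ the players are the nodes, the strategy set of node $i$ is $C(i)$, and for a joint strategy $s$ (with $s(i)\in C(i)$ for all $i$) the payoff of $i$ is $p_i(s)=\sum_{j\in N_i:\,s(i)=s(j)} w_{j\to i}+\beta(i,s(i))$, where $N_i=\{j : (j\to i)\in E\}$. We write $(x,s_{-i})$ for the joint strategy obtained from $s$ by changing the strategy of $i$ to $x$. A (pure) Nash equilibrium is a joint strategy $s$ such that for every $i$ and every $x\in C(i)$, $p_i(s)\ge p_i(x,s_{-i})$. A query is a function $q:Q\to M$ with $\emptyset\ne Q\subseteq V$ and $q(i)\in C(i)$ for all $i\in Q$. It is monochromatic if $q(i)=q(j)$ for all $i,j\in Q$. A joint strategy $s$ is consistent with $q$ if $s(i)=q(i)$ for all $i\in Q$. $\exists$NE problem: given $G,w,C,\beta,q$, decide whether some Nash equilibrium of $\mathcal{G}(G,w,C,\beta)$ is consistent with $q$. With two colours, $M=\{0,1\}$, and for a monochromatic query it is assumed without loss of generality (renaming colours)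 that $q(i)=0$ for all $i\in Q$. Algorithm A. Input: a coordination game $\mathcal{G}((V,E),w,C,\beta)$ and a monochromatic query $q:Q\to M$. Output: YES if there is a Nash equilibrium consistent with $q$, NO otherwise. (1) For each $i\in V$: if $0\in C(i)$ set $s(i)=0$, else set $s(i)=1$. (2) Set $\mathcal{S}:=\{i : s(i)=1\}$. (3) While $\mathcal{S}\neq\emptyset$: remove any element $i$ from $\mathcal{S}$; for each $j\in V$ with $(i\to j)\in E$: if $s(j)=0$ and $1\in C(j)$ and $p_j((1,s_{-j}))>p_j(s)$, then set $s(j)=1$ and add $j$ to $\mathcal{S}$. (4) If $s(i)=0$ for all $i\in Q$ return YES, else return NO. The size of the game graph is $|G|=\mathcal{O}(nm+e)$. Weights and bonuses are given in binary; running time is measured in the number of arithmetic operations.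
   Formalization: Algorithm A as given fails when a bonus alone makes a node prefer colour 1 (no edges, β(i,1)>β(i,0), q=0). Here it runs after deleting from each C(i) the colours strictly dominated by bonuses alone, within the O(|G|) bound; if β=0 nothing is deleted. *)

(* Defs.v *)
From HB Require Import structures.
From mathcomp Require Import all_boot all_order all_algebra perm.

Set Implicit Arguments.
Unset Strict Implicit.
Unset Printing Implicit Defensive.

Import Order.TTheory GRing.Theory Num.Theory.

Local Open Scope ring_scope.

(** * Coordination games *)

(* [weight] is meaningful only on the edges. *)
Record game (n : nat) (M : finType) := Game {
  edge : rel 'I_n;
  weight : 'I_n -> 'I_n -> rat;
  colours : 'I_n -> {set M};
  bonus : 'I_n -> M -> int }.

Definition edges n (M : finType) (G : game n M) : {set 'I_n * 'I_n} :=
  [set p | edge G p.1 p.2].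

Definition well_formed n (M : finType) (G : game n M) : Prop :=
  [/\ irreflexive (edge G),
      forall i j, edge G i j -> 0 <= weight G i j &
      forall i, colours G i != set0].

Definition gsize n (M : finType) (G : game n M) : nat :=
  (n * #|M| + #|edges G|)%N.

Definition strategy n (M : finType) := {ffun 'I_n -> M}.

Definition joint_strategy n (M : finType) (G : game n M) (s : strategy n M) :=
  forall i, s i \in colours G i.

Definition deviate n (M : finType) (x : M) (i : 'I_n) (s : strategy n M) :
    strategy n M :=
  [ffun j => if j == i then x else s j].

Definition payoff n (M : finType) (G : game n M) (i : 'I_n)
    (s : strategy n M) : rat :=
  \sum_(j | edge G j i && (s i == s j)) weight G j i + (bonus G i (s i))%:~R.

Definition Nash n (M : finType) (G : game n M) (s : strategy n M) : Prop :=
  joint_strategy G s /\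
  forall i x, x \in colours G i -> payoff G i (deviate x i s) <= payoff G i s.

(* The partial function q : Q -> M, with [q i = None] for i outside Q. *)
Definition query n (M : finType) := {ffun 'I_n -> option M}.

Definition is_query n (M : finType) (G : game n M) (q : query n M) : Prop :=
  (exists i, q i != None) /\
  (forall i x, q i = Some x -> x \in colours G i).

Definition monochromatic n (M : finType) (q : query n M) : Prop :=
  forall i j x y, q i = Some x -> q j = Some y -> x = y.

Definition consistent n (M : finType) (q : query n M) (s : strategy n M) :=
  forall i x, q i = Some x -> s i = x.

Definition exists_NE n (M : finType) (G : game n M) (q : query n M) : Prop :=
  exists s, Nash G s /\ consistent q s.

Definition recolour n (M : finType) (pi : {perm M}) (G : game n M) :
    game n M :=
  Game (edge G) (weight G) (fun i => pi @: colours G i)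
    (fun i x => bonus G i ((pi^-1)%g x)).

Definition recolour_query n (M : finType) (pi : {perm M}) (q : query n M) :
    query n M :=
  [ffun i => omap pi (q i)].

(* The renaming of the two colours that turns a monochromatic query into a
   query for colour 0. *)
Definition to_zero n (q : query n 'I_2) : {perm 'I_2} :=
  tperm (odflt 0 [pick x | [exists i, q i == Some x]]) 0.

(* Deletes from each C(i) the colours that bonuses alone make unplayable: i is
   better off with some y even if all its neighbours choose x and none
   chooses y. Such an x is strictly dominated, so the Nash equilibria are
   unchanged; without bonuses nothing is deleted.
   The worklist of Algorithm A reaches a node only through an edge leaving a
   node of colour 1, so it overlooks a node that wants colour 1 merely because
   of its bonus. For instance, with no edges, C(i) = {0,1} for every i,
   and b(i,1) > b(i,0), its worklist is empty from the start and it accepts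
   every query for colour 0, although no node has colour 0 in an equilibrium.
   The deletion is what makes the algorithm correct with bonuses. *)
Definition prune n (M : finType) (G : game n M) : game n M :=
  Game (edge G) (weight G)
    (fun i => [set x in colours G i |
       ~~ [exists y in colours G i,
             (bonus G i x)%:~R + \sum_(j | edge G j i) weight G j i
               < (bonus G i y)%:~R]])
    (bonus G).

(** * Algorithm A *)

(* [Remove] takes a node out of the set S; [Switch] and [Keep] are the two
   outcomes of examining the target of an edge leaving the removed node. *)
Variant action := Remove | Keep | Switch.

Definition event := (action * nat)%type.

(* [todo] holds the targets of the inner loop that are still to be examined. *)
Record config n := Config {
  strat : strategy n 'I_2;
  pool : {set 'I_n};
  todo : {set 'I_n} }.

Definition initial n (G : game n 'I_2) : config n :=
  let s : strategy n 'I_2 :=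
    [ffun i => if (0 : 'I_2) \in colours G i then 0 else 1] in
  Config s [set i | s i == 1] set0.

Definition wants_one n (G : game n 'I_2) (s : strategy n 'I_2) (j : 'I_n) :=
  [&& s j == 0, (1 : 'I_2) \in colours G j &
      payoff G j s < payoff G j (deviate 1 j s)].

(* All choices of "any element of S" and all orders of the inner loop are
   allowed. *)
Inductive step n (G : game n 'I_2) : config n -> event -> config n -> Prop :=
| StepRemove (s : strategy n 'I_2) (S : {set 'I_n}) (i : 'I_n) : i \in S ->
    step G (Config s S set0) (Remove, val i)
           (Config s (S :\ i) [set j | edge G i j])
| StepSwitch (s : strategy n 'I_2) (S T : {set 'I_n}) (j : 'I_n) : j \in T -> wants_one G s j ->
    step G (Config s S T) (Switch, val j)
           (Config (deviate 1 j s) (j |: S) (T :\ j))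
| StepKeep (s : strategy n 'I_2) (S T : {set 'I_n}) (j : 'I_n) : j \in T -> ~~ wants_one G s j ->
    step G (Config s S T) (Keep, val j) (Config s S (T :\ j)).

Inductive steps n (G : game n 'I_2) :
    config n -> seq event -> config n -> Prop :=
| StepsNil k : steps G k [::] k
| StepsCons k1 ev k2 tr k3 :
    step G k1 ev k2 -> steps G k2 tr k3 -> steps G k1 (ev :: tr) k3.

Definition run n (G : game n 'I_2) (tr : seq event) (k : config n) : Prop :=
  steps G (initial G) tr k.

Definition terminal n (k : config n) : bool :=
  (pool k == set0) && (todo k == set0).

Definition answers_yes n (q : query n 'I_2) (k : config n) : bool :=
  [forall i, (q i != None) ==> (strat k i == 0)].

(** * Machine model *)

(* A random access machine programmed with while loops. Memory consists of
   numbered arrays of natural numbers and of rationals, and every access,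
   comparison, addition and subtraction costs one unit. There is deliberately
   no multiplication, division or rounding, and rationals cannot be used as
   addresses. *)

Inductive nexpr :=
| NConst of nat
| NGet of nat & nexpr
| NAdd of nexpr & nexpr
| NSub of nexpr & nexpr.

Inductive qexpr :=
| QConst of rat
| QGet of nat & nexpr
| QAdd of qexpr & qexpr
| QSub of qexpr & qexpr.

Inductive test :=
| NEq of nexpr & nexpr
| NLt of nexpr & nexpr
| QLt of qexpr & qexpr.

(* [Emit a e] appends the pair of a and the value of e to the write-only
   output tape; it lets one require that a program carry out a procedure and
   not merely compute the same result. *)
Inductive prog :=
| Skip
| NSet of nat & nexpr & nexpr
| QSet of nat & nexpr & qexpr
| Emit of action & nexpr
| Seq of prog & prog
| If of test & prog & prog
| While of test & prog.

Record store := Store {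
  nmem : nat -> nat -> nat;
  qmem : nat -> nat -> rat;
  tape : seq event }.

Definition update T (f : nat -> nat -> T) a i v : nat -> nat -> T :=
  fun b j => if (b == a) && (j == i) then v else f b j.

Fixpoint neval (st : store) (e : nexpr) : nat :=
  match e with
  | NConst k => k
  | NGet a i => nmem st a (neval st i)
  | NAdd e1 e2 => (neval st e1 + neval st e2)%N
  | NSub e1 e2 => (neval st e1 - neval st e2)%N
  end.

Fixpoint qeval (st : store) (e : qexpr) : rat :=
  match e with
  | QConst r => r
  | QGet a i => qmem st a (neval st i)
  | QAdd e1 e2 => qeval st e1 + qeval st e2
  | QSub e1 e2 => qeval st e1 - qeval st e2
  end.

Definition teval (st : store) (b : test) : bool :=
  match b with
  | NEq e1 e2 => neval st e1 == neval st e2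
  | NLt e1 e2 => (neval st e1 < neval st e2)%N
  | QLt e1 e2 => qeval st e1 < qeval st e2
  end.

Fixpoint ncost (e : nexpr) : nat :=
  match e with
  | NConst _ => 1
  | NGet _ i => (ncost i).+1
  | NAdd e1 e2 | NSub e1 e2 => (ncost e1 + ncost e2)%N.+1
  end.

Fixpoint qcost (e : qexpr) : nat :=
  match e with
  | QConst _ => 1
  | QGet _ i => (ncost i).+1
  | QAdd e1 e2 | QSub e1 e2 => (qcost e1 + qcost e2)%N.+1
  end.

Definition tcost (b : test) : nat :=
  match b with
  | NEq e1 e2 | NLt e1 e2 => (ncost e1 + ncost e2)%N.+1
  | QLt e1 e2 => (qcost e1 + qcost e2)%N.+1
  end.

(* [exec P st st' t]: started in st, P halts in st' after t operations. *)
Inductive exec : prog -> store -> store -> nat -> Prop :=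
| ExecSkip st : exec Skip st st 1
| ExecNSet a i e st :
    exec (NSet a i e) st
      (Store (update (nmem st) a (neval st i) (neval st e)) (qmem st) (tape st))
      (ncost i + ncost e)%N.+1
| ExecQSet a i e st :
    exec (QSet a i e) st
      (Store (nmem st) (update (qmem st) a (neval st i) (qeval st e)) (tape st))
      (ncost i + qcost e)%N.+1
| ExecEmit a e st :
    exec (Emit a e) st
      (Store (nmem st) (qmem st) (rcons (tape st) (a, neval st e)))
      (ncost e).+1
| ExecSeq P1 P2 st1 st2 st3 t1 t2 :
    exec P1 st1 st2 t1 -> exec P2 st2 st3 t2 ->
    exec (Seq P1 P2) st1 st3 (t1 + t2)%N
| ExecIfTrue b P1 P2 st1 st2 t : teval st1 b ->
    exec P1 st1 st2 t -> exec (If b P1 P2) st1 st2 (tcost b + t)%N.+1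
| ExecIfFalse b P1 P2 st1 st2 t : ~~ teval st1 b ->
    exec P2 st1 st2 t -> exec (If b P1 P2) st1 st2 (tcost b + t)%N.+1
| ExecWhileTrue b P st1 st2 st3 t1 t2 : teval st1 b ->
    exec P st1 st2 t1 -> exec (While b P) st2 st3 t2 ->
    exec (While b P) st1 st3 (tcost b + t1 + t2)%N.+1
| ExecWhileFalse b P st : ~~ teval st b ->
    exec (While b P) st st (tcost b).+1.

(* Input. The natural arrays 0-4 hold: the pair (n, e); the sources of the
   edges; their targets; the n x 2 membership table of C (entry 2i + x is 1
   if x is in C(i) and 0 otherwise); the query (0 outside Q, q(i) + 1 on Q).
   The rational arrays 0-1 hold the weights of the edges and the n x 2 table
   of bonuses. All other cells are 0. The edges come in the order of es. *)
Definition load n (G : game n 'I_2) (q : query n 'I_2)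
    (es : seq ('I_n * 'I_n)) : store :=
  let narrays : seq (seq nat) :=
    [:: [:: n; size es];
        [seq val p.1 | p <- es];
        [seq val p.2 | p <- es];
        [seq nat_of_bool (x \in colours G i) | i <- enum 'I_n, x <- enum 'I_2];
        [seq (if q i is Some x then (val x).+1 else 0%N) | i <- enum 'I_n]] in
  let qarrays : seq (seq rat) :=
    [:: [seq weight G p.1 p.2 | p <- es];
        [seq (bonus G i x)%:~R | i <- enum 'I_n, x <- enum 'I_2]] in
  Store (fun a i => nth 0%N (nth [::] narrays a) i)
        (fun a i => nth 0 (nth [::] qarrays a) i)
        [::].

(* Output: cell 0 of the natural array 5. *)
Definition outputs_yes (st : store) : bool := nmem st 5 0 == 1%N.

(* Main.v *)
Require Import Defs.
From HB Require Import structures.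
From mathcomp Require Import all_boot all_order all_algebra perm.
From mathcomp Require Import zify ring.

(** Enlarging the set of nodes of colour 1 raises every payoff for colour 1 and
    lowers every payoff for colour 0. Hence each node that Algorithm A switches
    has colour 1 in every Nash equilibrium. Conversely, a node that would rather
    have colour 1 is always either about to be examined or an out-neighbour of
    the worklist; initially this holds because pruning rules out a node that
    wants colour 1 without a neighbour of colour 1. So the final strategy is the
    least Nash equilibrium, and it decides the query for colour 0.

    For linear time, the machine stores for each node the difference of its two
    payoffs, so that a node is examined in constant time; a switch updates the
    differences of the out-neighbours. Every node switches at most once and
    leaves the worklist at most once, and the edges leaving a node are threaded
    in a linked list, so the out-edges are traversed at most twice in total. *)

Set Implicit Arguments.
Unset Strict Implicit.
Unset Printing Implicit Defensive.

Import Order.TTheory GRing.Theory Num.Theory.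

Local Open Scope ring_scope.

(** * Equilibria and Algorithm A *)

Lemma ord2_eq1 (x : 'I_2) : (x == 1) = (x != 0).
Proof. by case: x => [[|[|m]] hm]. Qed.

Lemma ord2_cases (x : 'I_2) : x = 0 \/ x = 1.
Proof. by case: (eqVneq x 0) => [|h]; [left | right; apply/eqP; rewrite ord2_eq1]. Qed.

(** * Payoffs, pruning and renaming of colours *)

Section Games.
Context (n : nat) (M : finType).
Implicit Types (G : game n M) (s : strategy n M) (q : query n M).

(** Without self loops this does not depend on [s i], so the payoffs of both colours can be compared
    against one strategy, without [deviate]. *)
Definition payoff_at G i s x : rat :=
  \sum_(j | edge G j i && (s j == x)) weight G j i + (bonus G i x)%:~R.

Lemma payoffE G i s : payoff G i s = payoff_at G i s (s i).
Proof.
by congr (_ + _); apply: eq_bigl => j; rewrite [s i == _]eq_sym.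
Qed.

Lemma payoff_deviate G i s x : irreflexive (edge G) ->
  payoff G i (deviate x i s) = payoff_at G i s x.
Proof.
move=> irr; rewrite payoffE /payoff_at !ffunE eqxx; congr (_ + _).
apply: eq_bigl => j; rewrite ffunE; case: (eqVneq j i) => // ->.
by rewrite irr.
Qed.

Definition inweight G i : rat := \sum_(j | edge G j i) weight G j i.

Section WellFormed.
Variable G : game n M.
Hypothesis wfG : well_formed G.

Lemma inweight_ge0 i : 0 <= inweight G i.
Proof. by case: wfG => _ w0 _; apply: sumr_ge0 => j; apply: w0. Qed.

Lemma payoff_at_ge_bonus i s x : (bonus G i x)%:~R <= payoff_at G i s x.
Proof.
case: wfG => _ w0 _; rewrite lerDr; apply: sumr_ge0 => j /andP[? _].
exact: w0.
Qed.

Lemma payoff_at_le i s x : payoff_at G i s x <= (bonus G i x)%:~R + inweight G i.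
Proof.
case: wfG => _ w0 _; rewrite [leRHS]addrC lerD2r /inweight.
rewrite [leRHS](bigID (fun j => s j == x)) /= lerDl.
by apply: sumr_ge0 => j /andP[? _]; apply: w0.
Qed.

Lemma NashE s : Nash G s <-> joint_strategy G s /\
  forall i x, x \in colours G i -> payoff_at G i s x <= payoff_at G i s (s i).
Proof.
case: wfG => irr _ _; rewrite /Nash.
by split=> -[js H]; split=> // i x /H; rewrite payoff_deviate // payoffE.
Qed.

Lemma mem_prune i x : (x \in colours (prune G) i) = (x \in colours G i) &&
  ~~ [exists y in colours G i, (bonus G i x)%:~R + inweight G i < (bonus G i y)%:~R :> rat].
Proof. by rewrite inE. Qed.

(** A colour of maximal bonus is never deleted: adding the nonnegative in-weight keeps it at least
    as large as any other bonus. *)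
Lemma prune_max i : exists2 y, y \in colours (prune G) i &
  forall x, x \in colours G i -> bonus G i x <= bonus G i y.
Proof.
case: wfG => _ _ /(_ i) /set0Pn[x0 x0C].
case: (@Order.TotalTheory.arg_maxP _ _ _ x0 (mem (colours G i)) (bonus G i) x0C).
move=> y yC ymax; exists y => //; rewrite mem_prune [_ \in _]yC /=.
apply/existsPn => z; rewrite negb_and; case zC: (z \in _) => //=.
rewrite -leNgt; apply: (@le_trans _ _ (bonus G i y)%:~R).
  by rewrite ler_int; apply: ymax.
by rewrite lerDl inweight_ge0.
Qed.

Lemma well_formed_prune : well_formed (prune G).
Proof.
case: wfG => irr w0 ne; split=> // i.
by have [y yC _] := prune_max i; apply/set0Pn; exists y.
Qed.

End WellFormed.

(** A deviation to a deleted colour earns less than some bonus, hence less than a surviving colour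
    of maximal bonus. Conversely, an equilibrium cannot use a deleted colour, since the colour that
    dominates it would be a profitable deviation. *)
Lemma Nash_prune G s : well_formed G -> Nash (prune G) s <-> Nash G s.
Proof.
move=> wf; rewrite (NashE (well_formed_prune wf)) (NashE wf); split=> -[js ns].
  have jsG : joint_strategy G s by move=> i; have := js i; rewrite mem_prune => /andP[].
  split=> // i x xC.
  have [y yP ymax] := prune_max wf i.
  case xP: (x \in colours (prune G) i); first exact: ns.
  move: xP; rewrite mem_prune xC /= => /negbFE/exists_inP[z zC zlt].
  have := ns i y yP; apply: le_trans.
  apply: le_trans (payoff_at_le wf _ _ _) _.
  apply: le_trans (ltW zlt) _.
  apply: le_trans (payoff_at_ge_bonus wf _ _ _).
  by rewrite ler_int ymax.
split=> [i|i x]; last by rewrite mem_prune => /andP[+ _]; exact: ns.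
rewrite mem_prune js /=; apply/exists_inPn => y yC; rewrite -leNgt.
apply: le_trans (payoff_at_ge_bonus wf i s y) _.
exact: le_trans (ns i y yC) (payoff_at_le wf _ _ _).
Qed.

Lemma exists_NE_prune G q : well_formed G ->
  exists_NE (prune G) q <-> exists_NE G q.
Proof.
by move=> wf; split=> -[s [/(Nash_prune s wf) ? ?]]; exists s.
Qed.

Lemma well_formed_recolour (pi : {perm M}) G :
  well_formed G -> well_formed (recolour pi G).
Proof.
case=> irr w0 ne; split=> // i; apply/set0Pn.
by have /set0Pn[x xC] := ne i; exists (pi x); apply/imsetP; exists x.
Qed.

Lemma mem_recolour (pi : {perm M}) G i x :
  (x \in colours (recolour pi G) i) = ((pi^-1)%g x \in colours G i).
Proof.
rewrite -{1}[x](permKV pi) /= mem_imset //; exact: perm_inj.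
Qed.

Definition recolour_strategy (pi : {perm M}) s : strategy n M :=
  [ffun i => pi (s i)].

Lemma exists_NE_recolour (pi : {perm M}) G q : well_formed G ->
  exists_NE G q <-> exists_NE (recolour pi G) (recolour_query pi q).
Proof.
move=> wf; have wf' := well_formed_recolour pi wf.
have pE s i x : payoff_at (recolour pi G) i (recolour_strategy pi s) x
   = payoff_at G i s ((pi^-1)%g x).
  congr (_ + _); apply: eq_bigl => j; rewrite ffunE.
  by rewrite -(inj_eq (@perm_inj _ (pi^-1)%g)) permK.
split=> -[s [/NashE-/(_ _)[]// js ns cs]].
  exists (recolour_strategy pi s); split.
    apply/NashE => //; split=> [i|i x]; first by rewrite mem_recolour ffunE permK.
    by rewrite mem_recolour !pE ffunE permK; exact: ns.
  move=> i x; rewrite !ffunE; case qi: (q i) => [y|] //= [<-].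
  by rewrite (cs i y).
(* Renaming is onto, so [pE] also covers an arbitrary strategy of the renamed game. *)
pose t := recolour_strategy (pi^-1)%g s.
have st : s = recolour_strategy pi t.
  by apply/ffunP => i; rewrite !ffunE permKV.
exists t; split.
  apply/NashE => //; split=> [i|i x xC].
    by have := js i; rewrite mem_recolour ffunE.
  have := ns i (pi x); rewrite mem_recolour permK => /(_ xC).
  by rewrite st !pE [recolour_strategy _ _ _]ffunE !permK.
move=> i x qi; rewrite ffunE (cs i (pi x)) ?permK //.
by rewrite ffunE qi.
Qed.

End Games.

(** * Soundness of Algorithm A *)

Section AlgorithmA.
Context (n : nat) (G : game n 'I_2).
Implicit Types (s : strategy n 'I_2) (k : config n) (S T : {set 'I_n}).

Hypothesis wfG : well_formed G.

Let irrG : irreflexive (edge G). Proof. by case: wfG. Qed.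

Lemma wants_oneE s j : wants_one G s j =
  [&& s j == 0, 1 \in colours G j & payoff_at G j s 0 < payoff_at G j s 1].
Proof.
rewrite /wants_one; case: eqP => //= sj.
by rewrite payoff_deviate // payoffE sj.
Qed.

Lemma payoff_at_1_mono s s' j : (forall i, s i = 1 -> s' i = 1) ->
  payoff_at G j s 1 <= payoff_at G j s' 1.
Proof.
case: wfG => _ w0 _ le; rewrite lerD2r.
rewrite [leLHS]big_mkcond [leRHS]big_mkcond /=; apply: ler_sum => i _.
case e: (edge G i j) => //=; case: eqP => [/le ->|_]; first by rewrite eqxx.
by case: ifP => // _; apply: w0.
Qed.

Lemma payoff_at_0_anti s s' j : (forall i, s i = 1 -> s' i = 1) ->
  payoff_at G j s' 0 <= payoff_at G j s 0.
Proof.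
case: wfG => _ w0 _ le; rewrite lerD2r.
rewrite [leLHS]big_mkcond [leRHS]big_mkcond /=; apply: ler_sum => i _.
case e: (edge G i j) => //=; case: (ord2_cases (s i)) => si.
  by rewrite si; case: ifP => // _; apply: w0.
by rewrite (le _ si) si.
Qed.

(** The consequence of pruning on which soundness rests: colour 0 shared with all in-neighbours is
    worth at least colour 1 shared with none. *)
Definition pruned := forall j, (0 : 'I_2) \in colours G j -> (1 : 'I_2) \in colours G j ->
  (bonus G j 1)%:~R <= (bonus G j 0)%:~R + inweight G j :> rat.

(** [sound_least] keeps the strategy below every equilibrium. [sound_one] says that nodes of colour
    1 have no regret, and [sound_wants] that each dissatisfied node of colour 0 is still going to be
    examined. *)
Record sound k : Prop := Sound {
  sound_joint : joint_strategy G (strat k);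
  sound_least : forall s', Nash G s' -> forall i, strat k i = 1 -> s' i = 1;
  sound_one : forall j, strat k j = 1 -> (0 : 'I_2) \in colours G j ->
    payoff_at G j (strat k) 0 <= payoff_at G j (strat k) 1;
  sound_pool : forall i, i \in pool k -> strat k i = 1;
  sound_wants : forall j, wants_one G (strat k) j ->
    (j \in todo k) || [exists i in pool k, edge G i j] }.

Lemma sound_initial : pruned -> sound (initial G).
Proof.
move=> pr; have init1 i : strat (initial G) i = 1 -> (0 : 'I_2) \notin colours G i.
  by rewrite ffunE; case: ifP.
split.
- move=> i; rewrite ffunE; case: ifP => // C0.
  case: wfG => _ _ /(_ i) /set0Pn[x]; case: (ord2_cases x) => -> //.
  by rewrite C0.
- move=> s' [js _] i /init1 C0; case: (ord2_cases (s' i)) => // s0.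
  by have := js i; rewrite s0 (negbTE C0).
- by move=> j /init1/negbTE ->.
- by move=> i; rewrite inE => /eqP.
- move=> j; rewrite wants_oneE => /and3P[s0 C1 lt]; apply/orP; right.
  (* With no in-neighbour of colour 1, colour 0 earns the whole in-weight and colour 1 only its
     bonus, so [pruned] excludes a gain. *)
  apply: contraLR lt; rewrite -leNgt => /exists_inPn noe.
  have z i : edge G i j -> strat (initial G) i = 0.
    move=> e; case: (ord2_cases (strat (initial G) i)) => // s1.
    by have := noe i; rewrite inE s1 eqxx e => /(_ isT).
  rewrite /payoff_at big1 => [|i /andP[/z -> /eqP]//].
  rewrite add0r addrC (eq_bigl (fun i => edge G i j)) => [|i].
    apply: pr => //; move: s0; rewrite ffunE.
    by case: ifP.
  by case e: (edge G i j) => //=; rewrite z.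
Qed.

Lemma deviate1_le s j i : s i = 1 -> deviate 1 j s i = 1.
Proof. by rewrite ffunE; case: eqP. Qed.

Lemma payoff_at_deviate s i j x y : ~~ edge G i j ->
  payoff_at G j (deviate y i s) x = payoff_at G j s x.
Proof.
move=> ne; congr (_ + _); apply: eq_bigl => l; rewrite ffunE.
by case: (eqVneq l i) => // ->; rewrite !(negbTE ne).
Qed.

Lemma sound_step k ev k' : sound k -> step G k ev k' -> sound k'.
Proof.
move=> + st; case: st => {k ev k'} [s S i iS|s S T j jT wj|s S T j jT wj] [] /= js le one po wa.
- split=> //= [l /setD1P[_]|j /wa]; first exact: po.
  rewrite in_set0 /= => /exists_inP[l lS e]; rewrite inE.
  case: (eqVneq l i) e => [-> -> //|li e]; apply/orP; right.
  by apply/exists_inP; exists l => //; rewrite !inE li.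
- move: (wj); rewrite wants_oneE => /and3P[/eqP sj C1 lt].
  have up := @deviate1_le s j.
  split=> /=.
  + by move=> i; rewrite ffunE; case: eqP => [->|_].
  + move=> s' Ns' i; rewrite ffunE; case: eqP => [->|_]; last exact: le.
    (* The equilibrium [s'] has at least the nodes of colour 1 of [s], so the strict gain of [j]
       from colour 1 persists against [s'] by monotonicity, and [s' j = 0] is impossible. *)
    case: (ord2_cases (s' j)) => // s'j _; have [_ /(_ j 1 C1)] := (NashE wfG s').1 Ns'.
    rewrite s'j leNgt => /negP[]; apply: le_lt_trans (payoff_at_0_anti _ (le _ Ns')) _.
    exact: lt_le_trans lt (payoff_at_1_mono _ (le _ Ns')).
  + move=> i si C0; apply: le_trans (payoff_at_0_anti _ up) _.
    apply: le_trans (payoff_at_1_mono _ up).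
    move: si; rewrite ffunE; case: eqP => [-> _|_ si]; first exact: ltW.
    exact: one.
  + by move=> i /setU1P[->|/po /up //]; rewrite ffunE eqxx.
  (* Out-neighbours of [j] are covered because [j] enters the pool; the payoffs of all other nodes
     are unchanged. *)
  + move=> i wi; case: (boolP (edge G j i)) => e.
      by apply/orP; right; apply/exists_inP; exists j; rewrite ?setU11.
    move: wi; rewrite wants_oneE !payoff_at_deviate // ffunE.
    case: (eqVneq i j) => // ij; rewrite -wants_oneE => /wa.
    rewrite !inE ij => /orP[->//|/exists_inP[l lS el]]; apply/orP; right.
    by apply/exists_inP; exists l; rewrite // !inE lS orbT.
- split=> //= i wi; have := wa i wi; rewrite !inE.
  by case: (eqVneq i j) wi wj => [-> ->|].
Qed.

Lemma sound_run tr k : pruned -> run G tr k -> sound k.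
Proof.
move=> /sound_initial; rewrite /run; move: (initial G) => k0 s0 st.
by elim: st s0 => // k1 ev k2 tr' k3 /[swap] _ /[swap] IH st s1; apply: IH; apply: sound_step st.
Qed.

Lemma Nash_terminal k : sound k -> terminal k -> Nash G (strat k).
Proof.
case=> js _ one _ wa /andP[/eqP p0 /eqP t0]; apply/NashE => //; split=> // i x xC.
case: (ord2_cases (strat k i)) (ord2_cases x) => si [] xE; rewrite si xE //; last first.
  by apply: one; rewrite // -xE.
rewrite leNgt; apply: contraT => /negbNE lt.
have := wa i; rewrite wants_oneE si lt -xE xC p0 t0 in_set0 => /(_ isT)/exists_inP[l].
by rewrite in_set0.
Qed.

Definition zero_query (q : query n 'I_2) := forall i x, q i = Some x -> x = 0.

(** If the answer is yes, the final strategy is itself a witness. Otherwise some queried node has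
    colour 1 there, hence in every equilibrium, and no equilibrium is consistent with the query. *)
Lemma answers_yesP (q : query n 'I_2) tr k : pruned -> zero_query q ->
  run G tr k -> terminal k -> (answers_yes q k <-> exists_NE G q).
Proof.
move=> pr q0 /(sound_run pr) sk tk; split=> [/forallP yes|[s' [Ns' cs]]].
  exists (strat k); split; first exact: Nash_terminal.
  by move=> i x qi; have := yes i; rewrite qi /= => /eqP ->; rewrite (q0 _ _ qi).
apply/forallP => i; apply/implyP; case qi: (q i) => [x|] // _.
case: (ord2_cases (strat k i)) => [->//|/(sound_least sk Ns')].
by rewrite (cs _ _ qi) (q0 _ _ qi).
Qed.

(** * Length of runs *)

Definition outdeg i := #|[set j | edge G i j]|.

(* A node of colour 0 counts twice: when it switches, its out-edges are
   traversed once to update the payoffs of its out-neighbours, and once more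
   when it leaves the worklist. *)
Definition potential k : nat :=
  (#|todo k| + \sum_(i in pool k) (outdeg i).+1
   + \sum_(i | strat k i == 0%R) 2 * (outdeg i).+1)%N.

Lemma potential_remove s S i : i \in S ->
  potential (Config s S set0) =
  (potential (Config s (S :\ i) [set j | edge G i j])).+1.
Proof.
move=> iS; rewrite /potential /= (big_setD1 i iS) /= cards0.
by rewrite -/(outdeg i); lia.
Qed.

Lemma potential_keep s S T j : j \in T ->
  potential (Config s S T) = (potential (Config s S (T :\ j))).+1.
Proof. by move=> jT; rewrite /potential /= (cardsD1 j T) jT !addSn. Qed.

(** The node gives up its double share and takes at most a single one in the pool. The surplus
    [outdeg j] pays the machine for updating the out-neighbours. *)
Lemma potential_switch s S T j : j \in T -> s j = 0 ->
  (potential (Config (deviate 1%R j s) (j |: S) (T :\ j)) + outdeg j + 2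
   <= potential (Config s S T))%N.
Proof.
move=> jT sj; rewrite /potential /= (cardsD1 j T) jT !add1n.
rewrite [(\sum_(i | s i == _) _)%N](bigD1 j) ?sj //=.
have -> : (\sum_(i < n | deviate 1%R j s i == 0%R) 2 * (outdeg i).+1 =
           \sum_(i < n | (s i == 0%R) && (i != j)) 2 * (outdeg i).+1)%N.
  apply: eq_bigl.
  by move=> i; rewrite ffunE; case: (eqVneq i j); rewrite /= ?andbF ?andbT.
have le : (\sum_(i in j |: S) (outdeg i).+1 <= (outdeg j).+1 + \sum_(i in S) (outdeg i).+1)%N.
  case jS: (j \in S); last by rewrite big_setU1 ?jS.
  by rewrite (setUidPr _) ?sub1set // leq_addl.
have arith t a b c d : (a <= d.+1 + b -> t + a + c + d + 2 <= t.+1 + b + (2 * d.+1 + c))%N.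
  by lia.
exact: arith le.
Qed.

Lemma potential_step k ev k' : step G k ev k' -> (potential k' < potential k)%N.
Proof.
case=> [s S i iS|s S T j jT wj|s S T j jT wj].
- by rewrite (potential_remove s iS).
- have /andP[/eqP sj _] := wj; apply: leq_trans (potential_switch S jT sj).
  by rewrite -addnA -addn1 leq_add2l; lia.
- by rewrite (potential_keep s S jT).
Qed.

Lemma sum_outdeg : (\sum_i outdeg i = #|edges G|)%N.
Proof.
rewrite -sum1_card (partition_big (fun p => p.1) xpredT) //=; apply: eq_bigr => i _.
rewrite /outdeg -sum1_card.
rewrite [RHS](reindex_onto (fun j => (i, j)) snd) /=; last first.
  by case=> a b /= /andP[_ /eqP ->].
by apply: eq_bigl => j; rewrite !inE !eqxx !andbT.
Qed.

(** Initially a node of colour 1 counts once, through the pool, and a node of colour 0 twice; the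
    shares [(outdeg i).+1] add up to the number of nodes plus the number of edges. *)
Lemma potential_initial : (potential (initial G) <= 2 * gsize G)%N.
Proof.
have e : (2 * \sum_i (outdeg i).+1 <= 2 * gsize G)%N.
  rewrite leq_mul2l /gsize card_ord -sum_outdeg /=.
  under eq_bigr do rewrite -addn1.
  rewrite big_split /= sum1_card card_ord.
  by rewrite addnC leq_add2r leq_pmulr.
apply: leq_trans e; rewrite /potential cards0 add0n /=.
rewrite [X in (_ <= _ * X)%N](bigID (fun i => strat (initial G) i == 0)) /= mulnDr addnC leq_add //.
  by rewrite -big_distrr.
rewrite mul2n -addnn; apply: leq_trans (leq_addr _ _).
by apply: eq_leq; apply: eq_bigl => i; rewrite inE ord2_eq1.
Qed.

Lemma size_run tr k : run G tr k -> (size tr <= 2 * gsize G)%N.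
Proof.
move=> r; apply: leq_trans potential_initial; move: r; rewrite /run.
move: (initial G) => k0; elim=> //= k1 ev k2 tr' k3 /potential_step lt _ le.
exact: leq_ltn_trans le lt.
Qed.

End AlgorithmA.

Local Open Scope nat_scope.

(** * Program logic with a budget of operations *)

(* [wp P Q st k]: P halts from st within k operations, and Q holds of the final
   store and of the operations left over. *)
Definition wp (P : prog) (Q : store -> nat -> Prop) (st : store) (k : nat) : Prop :=
  exists st' t, [/\ exec P st st' t, (t <= k)%N & Q st' (k - t)%N].

Definition set_nat st a i v :=
  Store (update (nmem st) a i v) (qmem st) (tape st).
Definition set_rat st a i v :=
  Store (nmem st) (update (qmem st) a i v) (tape st).
Definition emit st ev := Store (nmem st) (qmem st) (rcons (tape st) ev).

Lemma nmem_set_nat st a i v : nmem (set_nat st a i v) a i = v.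
Proof. by rewrite /= /update !eqxx. Qed.

Section WP.
Implicit Types (Q R : store -> nat -> Prop) (st : store) (k : nat).

Lemma wp_mono P Q R st k : wp P Q st k -> (forall st' k', Q st' k' -> R st' k') -> wp P R st k.
Proof. by case=> st' [t [ex le q]] QR; exists st', t; split=> //; apply: QR. Qed.

(** Runs a fragment specified with its own budget [b] inside a larger budget; the caller keeps at
    least [k - b]. *)
Lemma wp_frame P (R : store -> Prop) Q st b k : wp P (fun st' _ => R st') st b ->
  (b <= k)%N -> (forall st' k', R st' -> (k - b <= k')%N -> Q st' k') -> wp P Q st k.
Proof.
case=> st' [t [ex le r]] bk RQ; exists st', t; split=> //; first exact: leq_trans le bk.
by apply: RQ => //; lia.
Qed.

Lemma wp_skip Q st k : (1 <= k)%N -> Q st (k - 1)%N -> wp Skip Q st k.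
Proof. by move=> ? ?; exists st, 1%N; split=> //; constructor. Qed.

Lemma wp_nset a i e Q st k : ((ncost i + ncost e).+1 <= k)%N ->
  Q (set_nat st a (neval st i) (neval st e)) (k - (ncost i + ncost e).+1)%N ->
  wp (NSet a i e) Q st k.
Proof. by move=> ? ?; do 2!eexists; split; [constructor | | eassumption]. Qed.

Lemma wp_qset a i e Q st k : ((ncost i + qcost e).+1 <= k)%N ->
  Q (set_rat st a (neval st i) (qeval st e)) (k - (ncost i + qcost e).+1)%N ->
  wp (QSet a i e) Q st k.
Proof. by move=> ? ?; do 2!eexists; split; [constructor | | eassumption]. Qed.

Lemma wp_emit a e Q st k : ((ncost e).+1 <= k)%N ->
  Q (emit st (a, neval st e)) (k - (ncost e).+1)%N -> wp (Emit a e) Q st k.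
Proof. by move=> ? ?; do 2!eexists; split; [constructor | | eassumption]. Qed.

Lemma wp_seq P1 P2 Q st k : wp P1 (wp P2 Q) st k -> wp (Seq P1 P2) Q st k.
Proof.
case=> st1 [t1 [ex1 le1 [st2 [t2 [ex2 le2 q]]]]]; exists st2, (t1 + t2)%N; split.
- exact: ExecSeq ex1 ex2.
- lia.
- by rewrite subnDA.
Qed.

Lemma wp_if b P1 P2 Q st k : ((tcost b).+1 <= k)%N ->
  (teval st b -> wp P1 Q st (k - (tcost b).+1)%N) ->
  (~~ teval st b -> wp P2 Q st (k - (tcost b).+1)%N) -> wp (If b P1 P2) Q st k.
Proof.
move=> le h1 h2; case: (boolP (teval st b)) => [/[dup] tb /h1|/[dup] tb /h2] [st' [t [ex le' q]]];
  exists st', (tcost b + t).+1; split; first [exact: ExecIfTrue|exact: ExecIfFalse|lia|idtac];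
  by rewrite -addSn subnDA.
Qed.

(* Every iteration costs at least one operation, so the budget also bounds the
   number of iterations. *)
Lemma wp_while b P Q (I : store -> nat -> Prop) st k :
  (forall st k, I st k -> ((tcost b).+1 <= k)%N) ->
  (forall st k, I st k -> teval st b -> wp P I st (k - (tcost b).+1)%N) ->
  (forall st k, I st k -> ~~ teval st b -> Q st (k - (tcost b).+1)%N) ->
  I st k -> wp (While b P) Q st k.
Proof.
move=> hc ht hf; have [m] := ubnP k; elim: m st k => // m IH st k km Ik.
have ck := hc _ _ Ik; case: (boolP (teval st b)) => tb; last first.
  by exists st, (tcost b).+1; split=> //; [exact: ExecWhileFalse | exact: hf].
have [st1 [t1 [ex1 le1 I1]]] := ht _ _ Ik tb.
have [|st2 [t2 [ex2 le2 q]]] := IH _ _ _ I1; first by lia.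
exists st2, (tcost b + t1 + t2).+1; split.
- exact: ExecWhileTrue ex1 ex2.
- lia.
- by move: q; congr (Q _ _); lia.
Qed.

Definition for_loop v bound body :=
  Seq (NSet v (NConst 0) (NConst 0))
    (While (NLt (NGet v (NConst 0)) bound)
       (Seq body (NSet v (NConst 0) (NAdd (NGet v (NConst 0)) (NConst 1))))).

(** An iteration takes [ncost bound + 4] for the test, at most [B] for the body and 6 for the
    increment. Initialisation and the last test take [ncost bound + 7]. *)
Lemma wp_for v bound body (I : nat -> store -> Prop) B N Q st k :
  (forall x st, I x st -> neval st bound = N) ->
  (forall x st, (x < N)%N -> I x st -> nmem st v 0 = x ->
     wp body (fun st' _ => nmem st' v 0 = x /\ I x.+1 (set_nat st' v 0 x.+1)) st B) ->
  I 0%N (set_nat st v 0 0) ->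
  (N * (B + ncost bound + 10) + (ncost bound + 10) <= k)%N ->
  (forall st' k', I N st' -> (k - (N * (B + ncost bound + 10) + (ncost bound + 10)) <= k')%N -> Q st' k') ->
  wp (for_loop v bound body) Q st k.
Proof.
move=> bN hb I0 le hQ; apply: wp_seq; apply: wp_nset => /=; first by lia.
move: le hQ; set C := (B + ncost bound + 10)%N; have CE : C = (B + ncost bound + 10)%N by [].
move: C CE => C CE le hQ.
(* The first bound pays for the remaining iterations; the second also preserves the surplus owed to
   the continuation. *)
apply: (@wp_while _ _ _ (fun st' k' => exists2 x, (x <= N)%N /\ nmem st' v 0 = x & I x st' /\
  ((N - x) * C + ncost bound + 4 <= k')%N /\ (k - (N * C + (ncost bound + 10)) + (N - x) * C + ncost bound + 4 <= k')%N)).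
- by move=> st' k' [x _ [_ [+ _]]]; move: ((N - x) * C)%N => u /=; lia.
- move=> st' k' [x [xN vx] [Ix [le1 le2]]] /=; rewrite vx (bN _ _ Ix) => {}xN.
  have nx : (N - x = (N - x.+1).+1)%N by lia.
  apply: wp_seq; apply: wp_frame (hb _ _ xN Ix vx) _ _ => [|st1 k1 [vx1 I1] k1le].
    by move: le1; rewrite nx mulSn; move: ((N - x.+1) * C)%N => u /=; lia.
  apply: wp_nset => /=.
    by move: le1 k1le; rewrite nx mulSn; move: ((N - x.+1) * C)%N => u /=; lia.
  exists x.+1.
    by rewrite xN /update /= !eqxx vx1 addn1.
  split; first by rewrite vx1 addn1.
  by move: le1 le2 k1le; rewrite nx mulSn; move: ((N - x.+1) * C)%N (N * C)%N => u v' /=; lia.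
- move=> st' k' [x [xN vx] [Ix [le1 le2]]] /=; rewrite vx (bN _ _ Ix) -leqNgt => Nx.
  have xN' : x = N by apply/eqP; rewrite eqn_leq xN.
  apply: hQ; first by rewrite -xN'.
  by move: le2; move: (N * C)%N ((N - x) * C)%N => u v' /=; lia.
- exists 0%N; first by rewrite nmem_set_nat.
  by split=> //; move: le; rewrite subn0; move: (N * C)%N => u /=; lia.
Qed.

End WP.

(** * The main loop *)

(* Arrays 5-15 and the rational arrays 2-3 are the work space. [q_inw] holds the
   total weight of the edges into each node, [q_gap] its payoff for colour 1
   minus its payoff for colour 0; the arrays from [a_top] on are used as scalars,
   and [a_zero] is the original name of colour 0 after the renaming. *)
Local Notation a_dim := 0 (only parsing).
Local Notation a_src := 1 (only parsing).
Local Notation a_tgt := 2 (only parsing).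
Local Notation a_mem := 3 (only parsing).
Local Notation a_query := 4 (only parsing).
Local Notation a_out := 5 (only parsing).
Local Notation a_zero := 6 (only parsing).
Local Notation a_next := 7 (only parsing).
Local Notation a_head := 8 (only parsing).
Local Notation a_col := 9 (only parsing).
Local Notation a_stack := 10 (only parsing).
Local Notation a_top := 11 (only parsing).
Local Notation a_i := 12 (only parsing).
Local Notation a_p := 13 (only parsing).
Local Notation a_j := 14 (only parsing).
Local Notation a_r := 15 (only parsing).
Local Notation q_weight := 0 (only parsing).
Local Notation q_bonus := 1 (only parsing).
Local Notation q_inw := 2 (only parsing).
Local Notation q_gap := 3 (only parsing).

Local Notation var a := (NGet a (NConst 0)).
Local Notation decr e := (NSub e (NConst 1)).
Local Notation add_to a i e := (QSet a i (QAdd (QGet a i) e)).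

Definition push e :=
  Seq (NSet a_stack (var a_top) e)
      (NSet a_top (NConst 0) (NAdd (var a_top) (NConst 1))).

(** When a neighbour turns from colour 0 to colour 1, its weight leaves one payoff and enters the
    other, so the gap moves by twice the weight. *)
Definition twice_weight e := QAdd (QGet q_weight e) (QGet q_weight e).

Definition raise_gaps :=
  While (NLt (NConst 0) (var a_r))
    (Seq (add_to q_gap (NGet a_tgt (decr (var a_r))) (twice_weight (decr (var a_r))))
         (NSet a_r (NConst 0) (NGet a_next (decr (var a_r))))).

Definition switch_node :=
  Seq (Emit Switch (var a_j))
 (Seq (NSet a_col (var a_j) (NConst 1))
 (Seq (push (var a_j))
 (Seq (NSet a_r (NConst 0) (NGet a_head (var a_j)))
      raise_gaps))).

Definition keep_node := Emit Keep (var a_j).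

Definition examine :=
  Seq (NSet a_j (NConst 0) (NGet a_tgt (decr (var a_p))))
 (Seq (If (NEq (NGet a_col (var a_j)) (NConst 0))
        (If (QLt (QConst 0) (QGet q_gap (var a_j))) switch_node keep_node)
        keep_node)
      (NSet a_p (NConst 0) (NGet a_next (decr (var a_p))))).

Definition worklist :=
  While (NLt (NConst 0) (var a_top))
    (Seq (NSet a_top (NConst 0) (decr (var a_top)))
    (Seq (Emit Remove (NGet a_stack (var a_top)))
    (Seq (NSet a_p (NConst 0) (NGet a_head (NGet a_stack (var a_top))))
         (While (NLt (NConst 0) (var a_p)) examine)))).

(** * Memory representation of configurations *)

Section Worklist.
Context (n : nat) (H : game n 'I_2) (es : seq ('I_n * 'I_n)) (Q : 'I_n -> nat).
Hypothesis wfH : well_formed H.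
Hypothesis esE : perm_eq es (enum (edges H)).
Implicit Types (s : strategy n 'I_2) (st : store).

Local Notation weight2 x := (weight H x.1 x.2 + weight H x.1 x.2)%R.

(* [p] is the head of the linked list of the edges [l]; the pointer [e.+1]
   stands for the edge number [e], and 0 for the end of the list. *)
Fixpoint chain (tgt next : nat -> nat) (w : nat -> rat) (p : nat) (l : seq ('I_n * 'I_n)) : Prop :=
  if l is x :: l' then
    exists e, [/\ p = e.+1, tgt e = x.2, w e = weight H x.1 x.2, next e <= e &
                  chain tgt next w (next e) l']
  else p = 0.

Lemma chain_nil tgt next w l : chain tgt next w 0 l -> l = [::].
Proof. by case: l => //= x l [e []]. Qed.

Lemma chain_cons tgt next w e l : chain tgt next w e.+1 l ->
  exists x l', [/\ l = x :: l', tgt e = x.2, w e = weight H x.1 x.2 & chain tgt next w (next e) l'].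
Proof.
case: l => //= x l [e' [[->] t we _ c]]; by exists x, l.
Qed.

(** In input order; the linked lists hold the reverse, because edges are prepended. *)
Definition out_edges i := [seq p <- es | p.1 == i].

Lemma uniq_es : uniq es.
Proof. by rewrite (perm_uniq esE) enum_uniq. Qed.

Lemma mem_es p : (p \in es) = edge H p.1 p.2.
Proof. by rewrite (perm_mem esE) mem_enum inE. Qed.

Lemma uniq_targets i : uniq [seq x.2 | x <- rev (out_edges i)].
Proof.
rewrite map_rev rev_uniq map_inj_in_uniq ?filter_uniq ?uniq_es // => -[a b] [c d].
by rewrite !mem_filter /= => /andP[/eqP -> _] /andP[/eqP -> _] ->.
Qed.

Lemma targetsE i : [set j in [seq x.2 | x <- rev (out_edges i)]] = [set j | edge H i j].
Proof.
apply/setP => j; rewrite !inE map_rev mem_rev.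
apply/mapP/idP => [[[a b]]|e].
  by rewrite mem_filter mem_es /= => /andP[/eqP -> e] ->.
by exists (i, j) => //; rewrite mem_filter eqxx mem_es.
Qed.

Lemma size_out_edges i : size (rev (out_edges i)) = outdeg H i.
Proof.
rewrite /outdeg -targetsE -(size_map snd) cardsE.
by rewrite (card_uniqP (uniq_targets i)).
Qed.

(** The form in which the machine accumulates the payoff difference: first as if all in-neighbours
    had colour 0, then corrected for each one of colour 1. *)
Definition gap s (j : 'I_n) : rat :=
  ((bonus H j 1%R)%:~R - (bonus H j 0%R)%:~R
   - \sum_(x <- es | x.2 == j) weight H x.1 x.2
   + \sum_(x <- es | (x.2 == j) && (s x.1 == 1)) weight2 x)%R.

Lemma sum_es (P : pred 'I_n) (F : 'I_n -> rat) j :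
  (\sum_(x <- es | (x.2 == j) && P x.1) F x.1 = \sum_(i | edge H i j && P i) F i)%R.
Proof.
rewrite (perm_big _ esE) /= big_enum_cond /=.
rewrite [LHS](reindex_onto (fun i => (i, j)) fst) /=; last first.
  by case=> a b /= /and3P[_ /eqP ->].
by apply: eq_bigl => i; rewrite inE /= !eqxx !andbT.
Qed.

Lemma sum_es_inweight j :
  (\sum_(x <- es | x.2 == j) weight H x.1 x.2 = inweight H j)%R.
Proof.
rewrite /inweight -(eq_bigl _ _ (fun i => andbT (edge H i j))).
rewrite -(sum_es predT (weight H ^~ j)).
by apply: congr_big => // [x|x /eqP ->]; rewrite ?andbT.
Qed.

Lemma gapE s j : gap s j = (payoff_at H j s 1%R - payoff_at H j s 0%R)%R.
Proof.
rewrite /gap /payoff_at sum_es_inweight /inweight.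
have -> : (\sum_(x <- es | (x.2 == j) && (s x.1 == 1)) weight2 x =
  \sum_(i | edge H i j && (s i == 1)) (weight H i j + weight H i j))%R.
  rewrite -(sum_es (fun i => s i == 1%R) (fun i => weight H i j + weight H i j)%R).
  by apply: eq_bigr => x /andP[/eqP -> _].
rewrite [(\sum_(i | edge H i j) _)%R](bigID (fun i => s i == 1%R)) /= big_split /=.
rewrite [X in (_ - (_ + X))%R](eq_bigl (fun i => edge H i j && (s i == 0%R))).
  by ring.
by move=> i; rewrite ord2_eq1 negbK.
Qed.

Lemma wants_one_gap s j : wants_one H s j =
  [&& s j == 0%R, 1%R \in colours H j & (0 < gap s j)%R].
Proof. by rewrite wants_oneE // gapE subr_gt0. Qed.

(** Exactly the edges leaving [j] enter the last sum of [gap] anew. They are listed in the order in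
    which [raise_gaps] walks them. *)
Lemma gap_deviate s j i : s j = 0%R -> gap (deviate 1%R j s) i =
  (gap s i + \sum_(x <- rev (out_edges j) | x.2 == i) weight2 x)%R.
Proof.
move=> sj; rewrite /gap -[RHS]addrA; congr (_ + _)%R.
rewrite big_rev big_filter_cond /=.
rewrite [LHS](bigID (fun x => x.1 == j)) /= addrC; congr (_ + _)%R.
  apply: eq_bigl => x; rewrite ffunE; case: (eqVneq x.1 j) => [->|_]; rewrite ?andbF ?andbT //.
  by rewrite sj andbF.
by apply: eq_bigl => x; rewrite ffunE; case: (eqVneq x.1 j); rewrite /= ?andbF ?andbT ?eqxx ?andbT.
Qed.

(* 1: colour 1; 0: colour 0, with colour 1 available; 2: colour 0 only. *)
Definition colour_code s (j : 'I_n) : nat :=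
  if s j == 1%R then 1 else if 1%R \in colours H j then 0 else 2.

(** Collects what stays constant once the edge lists are built and is read by the main loop and by
    [answer]. *)
Definition linked st :=
  [/\ nmem st a_dim 0 = n, forall i : 'I_n, nmem st a_query i = Q i &
      forall i : 'I_n, chain (nmem st a_tgt) (nmem st a_next) (qmem st q_weight)
                         (nmem st a_head i) (rev (out_edges i))].

(** The top of the stack is the end of [l]; cells above it may hold stale values. *)
Definition stacked st (l : seq 'I_n) :=
  nmem st a_top 0 = size l /\
  forall k, k < size l -> nmem st a_stack k = nth 0 (map val l) k.

Definition coloured st s := forall j : 'I_n, nmem st a_col j = colour_code s j.

Definition gapped st s := forall j : 'I_n, qmem st q_gap j = gap s j.

(** The tape must spell a run of Algorithm A that ends in the configuration represented by the
    store. Since [l] is duplicate-free, popping it removes the node from the pool. *)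
Definition rep st s (l : seq 'I_n) T :=
  [/\ linked st, coloured st s, stacked st l, gapped st s &
  [/\ uniq l, forall i, i \in l -> s i = 1%R & run H (tape st) (Config s [set i in l] T)]].

(** [F] stands for any property insensitive to the two arrays written here. The invariant is that
    each gap plus its contributions still in the list equals the target [g]; an iteration takes 36
    operations. *)
Lemma raise_gaps_spec (F : store -> Prop) (g : 'I_n -> rat) l st :
  (forall st i v, F st -> F (set_rat st q_gap i v)) ->
  (forall st v, F st -> F (set_nat st a_r 0 v)) ->
  F st -> chain (nmem st a_tgt) (nmem st a_next) (qmem st q_weight) (nmem st a_r 0) l ->
  (forall j : 'I_n, qmem st q_gap j + \sum_(x <- l | x.2 == j) weight2 x = g j)%R ->
  wp raise_gaps (fun st' _ => F st' /\ forall j : 'I_n, qmem st' q_gap j = g j) st (40 * size l + 10).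
Proof.
move=> Fq Fn F0 c0 g0.
apply: (@wp_while _ _ _ (fun st' k' => exists l', [/\ F st',
  chain (nmem st' a_tgt) (nmem st' a_next) (qmem st' q_weight) (nmem st' a_r 0) l',
  (forall j : 'I_n, qmem st' q_gap j + \sum_(x <- l' | x.2 == j) weight2 x = g j)%R &
  40 * size l' + 10 <= k'])).
- by move=> st' k' [l' [_ _ _ /=]]; lia.
- move=> st' k' [l' [F' c' g' le]] /=.
  case er: (nmem st' 15 0) c' => [|e] //= /chain_cons[x [l2 [lE te we c2]]] _.
  move: g' le; rewrite {}lE /= => g' le.
  apply: wp_seq; apply: wp_qset => /=; first by lia.
  apply: wp_nset => /=; first by lia.
  exists l2; split; [ exact/Fn/Fq | | | lia ].
  + by rewrite /= /update /= er subn1.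
  + move=> j; rewrite /= /update /= -g' big_cons er subn1 /= te.
    rewrite [j == _ :> nat]eq_sym.
    have -> : (val x.2 == val j) = (x.2 == j) by [].
    case: (eqVneq x.2 j) => [<-|_] /=; last by [].
    by rewrite we -addrA.
- move=> st' k' [l' [F' c' g' le]] /=; rewrite -eqn0Ngt => /eqP r0.
  split=> // j; rewrite -g'; move: c'; rewrite r0 => /chain_nil ->.
  by rewrite big_nil addr0.
- by exists l.
Qed.


(** [steps] grows at the front, whereas the tape grows at the back. *)
Lemma steps_rcons k1 tr k2 ev k3 : steps H k1 tr k2 -> step H k2 ev k3 ->
  steps H k1 (rcons tr ev) k3.
Proof.
elim=> [k|k ev' k' tr' k'' st _ IH] /= st'; first by apply: StepsCons st' (StepsNil _ _).
exact: StepsCons st (IH st').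
Qed.

Definition listed st (l : seq ('I_n * 'I_n)) :=
  chain (nmem st a_tgt) (nmem st a_next) (qmem st q_weight) (nmem st a_p 0) l.

Lemma switch_node_spec st s l T (j : 'I_n) rest :
  rep st s l T -> j \in T -> wants_one H s j -> nmem st a_j 0 = j -> listed st rest ->
  wp switch_node (fun st' _ => rep st' (deviate 1%R j s) (rcons l j) (T :\ j) /\ listed st' rest)
    st (40 * outdeg H j + 60).
Proof.
case=> lk col [top stk] gp [ul l1 rn] jT wj ej ls.
have /and3P[/eqP sj C1 _] : [&& s j == 0%R, 1%R \in colours H j & (0 < gap s j)%R].
  by rewrite -wants_one_gap.
have jl : j \notin l by apply/negP => /l1; rewrite sj.
have rn' := steps_rcons rn (StepSwitch [set i in l] jT wj).
apply: wp_seq; apply: wp_emit => /=; first by lia.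
apply: wp_seq; apply: wp_nset => /=; first by lia.
apply: wp_seq; apply: wp_seq; apply: wp_nset => /=; first by lia.
apply: wp_nset => /=; first by lia.
apply: wp_seq; apply: wp_nset => /=; first by lia.
set st1 := set_nat _ a_r _ _.
(* All of the new representation except the gaps already holds and survives [raise_gaps]. *)
pose F st' := [/\ linked st', coloured st' (deviate 1%R j s), stacked st' (rcons l j),
  tape st' = rcons (tape st) (Switch, val j) & listed st' rest].
apply: wp_frame (raise_gaps_spec (F := F) (g := gap (deviate 1%R j s))
  (l := rev (out_edges j)) _ _ _ _ _) _ _.
- by move=> st' i v.
- by move=> st' v.
- split.
  + exact: lk.
  + move=> i; rewrite /st1 /= /update /= ej /colour_code ffunE.
    case: (eqVneq i j) => [->|ij]; first by rewrite eqxx.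
    by rewrite -[_ == _ :> nat]/(i == j) (negbTE ij) /=; apply: col.
  + split.
      by rewrite /st1 /= /update /= top size_rcons addn1.
    move=> k; rewrite size_rcons ltnS => kl.
    rewrite /st1 /= /update /= top ej map_rcons nth_rcons size_map.
    by case: ltngtP kl => // kl _; apply: stk.
  + by rewrite /st1 /= ej.
  + exact: ls.
- by rewrite /st1 /= /update /= ej; case: lk.
- by move=> i; rewrite gap_deviate //; congr (_ + _)%R; apply: gp.
- by rewrite size_out_edges; lia.
move=> st' k' [[lk' col' st'' tp' ls'] gp'] _; split=> //; split=> //.
split.
- by rewrite rcons_uniq jl.
- move=> i; rewrite mem_rcons inE ffunE; case: (eqVneq i j) => //= _; exact: l1.
- rewrite tp' /run; suff -> : [set i in rcons l j] = j |: [set i in l] by [].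
  by apply/setP => i; rewrite !inE mem_rcons inE.
Qed.


Lemma colour_code_eq0 s j :
  (colour_code s j == 0) = (s j == 0%R) && (1%R \in colours H j).
Proof.
by rewrite /colour_code ord2_eq1; case: (s j == 0%R) => //=; case: (_ \in _).
Qed.

(** Each unit of potential is worth 100 operations; [c] is a reserve for work that does not lower
    the potential. *)
Definition funded k s (l : seq 'I_n) T c :=
  100 * potential H (Config s [set i in l] T) + c <= k.

Lemma examine_spec st k s l rest :
  rep st s l [set x in map snd rest] -> uniq (map snd rest) -> listed st rest ->
  funded k s l [set x in map snd rest] 30 ->
  wp (While (NLt (NConst 0) (var a_p)) examine)
    (fun st' k' => exists s' l', rep st' s' l' set0 /\ funded k' s' l' set0 20) st k.
Proof.
move=> r0 u0 l0 f0.
apply: (@wp_while _ _ _ (fun st' k' => exists s' l' rest', [/\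
  rep st' s' l' [set x in map snd rest'], uniq (map snd rest'), listed st' rest' &
  funded k' s' l' [set x in map snd rest'] 30])); last by exists s, l, rest.
- by move=> st' k' [s' [l' [rest' [_ _ _ /=]]]]; rewrite /funded; lia.
- move=> {r0 u0 l0 f0 s l rest st k} st k [s [l [[|x rest] [r u ls f]]]] /=.
    by rewrite ls.
  have [e [ep te _ _ _]] := ls; move=> _.
  pose j := x.2; have jT : j \in [set y in map snd (x :: rest)] by rewrite !inE eqxx.
  have /andP[jr u'] : (j \notin map snd rest) && uniq (map snd rest) by exact: u.
  have rE : [set y in map snd (x :: rest)] :\ j = [set y in map snd rest].
    by apply/setP => i; rewrite !inE; case: (eqVneq i j) => [->|//]; rewrite (negbTE jr).
  move: r f; set T := [set y in map snd (x :: rest)] in jT rE * => r f.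
  apply: wp_seq; apply: wp_nset => /=; first by move: f; rewrite /funded; lia.
  rewrite ep subn1 /= te.
  set st1 := set_nat _ _ _ _.
  have r1 : rep st1 s l T by exact: r.
  have ls1 : listed st1 (x :: rest) by exact: ls.
  have e1 : nmem st1 a_j 0 = j by rewrite nmem_set_nat.
  clearbody st1; have [lk col [top stk] gp [ul l1 rn]] := r1.
  apply: wp_seq.
  pose Q1 st' k' := exists s' l', [/\ rep st' s' l' (T :\ j),
    listed st' (x :: rest) & funded k' s' l' (T :\ j) 40].
  (* 57 is the 100 operations released by the drop in potential, less 3 for [Emit] and 40 for the
     reserve in [Q1]. *)
  have keep k' : ~~ wants_one H s j -> 100 * potential H (Config s [set i in l] T) <= k' + 57 ->
      wp keep_node Q1 st1 k'.
    move=> nw le; have := potential_keep H s [set i in l] jT => pk.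
    apply: wp_emit => /=; first by lia.
    exists s, l; split=> //; last by rewrite /funded; lia.
    split=> //; split=> //; rewrite /= e1.
    exact: steps_rcons rn (StepKeep [set i in l] jT nw).
  (* Code 0 means colour 0 with colour 1 available, so two constant-time tests decide
     [wants_one]. *)
  have wE : wants_one H s j = (nmem st1 a_col j == 0) && (0 < qmem st1 q_gap j)%R.
    by rewrite wants_one_gap andbA -colour_code_eq0 col gp.
  apply: (@wp_mono _ Q1).
    apply: wp_if => /= [|c0|c0]; first by move: f; rewrite /funded; lia.
      rewrite e1 in c0.
      apply: wp_if => /= [|c1|c1]; first by move: f; rewrite /funded; lia.
        rewrite e1 in c1.
        have wj : wants_one H s j by rewrite wE c0.
        have /andP[/eqP sj _] := wj; have := potential_switch H [set i in l] jT sj => ps.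
        apply: wp_frame (switch_node_spec r1 jT wj e1 ls1) _ _.
          by move: f; rewrite /funded; lia.
        move=> st' k' [r' ls'] le; exists (deviate 1%R j s), (rcons l j); split=> //.
        have lE : [set i in rcons l j] = j |: [set i in l].
          by apply/setP => i; rewrite !inE mem_rcons inE.
        by move: f le; rewrite /funded lE; lia.
      apply: keep; last by move: f; rewrite /funded; lia.
      by rewrite e1 in c1; rewrite wE negb_and c1 orbT.
    apply: keep; last by move: f; rewrite /funded; lia.
    by rewrite e1 in c0; rewrite wE negb_and c0.
  move=> st2 k2 [s' [l' [r2 [e2 [ep2 _ _ _ ls2]] f2]]].
  apply: wp_nset => /=; first by move: f2; rewrite /funded; lia.
  exists s', l', rest; rewrite -rE; split=> //.
    by rewrite /listed /= /update /= ep2 subn1.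
  by move: f2; rewrite /funded; lia.
move=> st' k' [s' [l' [rest' [r' _ ls' f']]]] /=; rewrite -eqn0Ngt => /eqP r0'.
exists s', l'; move: ls'; rewrite /listed r0' => /chain_nil rE.
move: r' f'; rewrite rE (_ : [set x in _] = set0); last by apply/setP => i; rewrite !inE.
by move=> r' f'; split=> //; move: f'; rewrite /funded; lia.
Qed.


Lemma worklist_spec st k s l : rep st s l set0 -> funded k s l set0 20 ->
  wp worklist (fun st' _ => exists s', rep st' s' [::] set0) st k.
Proof.
move=> r0 f0; apply: (@wp_while _ _ _ (fun st' k' => exists s' l',
  rep st' s' l' set0 /\ funded k' s' l' set0 20)); last by exists s, l.
- by move=> st' k' [s' [l' [_ /=]]]; rewrite /funded; lia.
- move=> {r0 f0 s l st k} st k [s [l [r f]]] /= top0.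
  have [lk col [top stk] gp [ul l1 rn]] := r.
  case/lastP: l => [|l i] in r f top stk ul l1 rn *; first by rewrite top in top0.
  have [il ul'] : i \notin l /\ uniq l by move: ul; rewrite rcons_uniq => /andP.
  have lE : [set j in rcons l i] :\ i = [set j in l].
    apply/setP => j; rewrite !inE mem_rcons inE.
    by case: (eqVneq j i) => [->|//]; rewrite (negbTE il).
  have iS : i \in [set j in rcons l i] by rewrite inE mem_rcons inE eqxx.
  have pr := potential_remove H s iS; rewrite lE in pr.
  have rn' := steps_rcons rn (StepRemove H s iS); rewrite lE in rn'.
  rewrite size_rcons in top stk; rewrite /funded pr in f.
  (* After the decrement of [a_top] the popped node sits just above the new top, where it can still
     be read. *)
  have ei : nmem st a_stack (size l) = i.
    by rewrite stk // map_rcons nth_rcons size_map ltnn eqxx.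
  apply: wp_seq; apply: wp_nset => /=; first by lia.
  rewrite top subn1 /=.
  apply: wp_seq; apply: wp_emit; first by move: f => /=; lia.
  apply: wp_seq; apply: wp_nset; first by move: f => /=; lia.
  have e1 : neval (set_nat st a_top 0 (size l)) (NGet a_stack (var a_top)) = i by exact: ei.
  rewrite e1.
  have -> ev : neval (emit (set_nat st a_top 0 (size l)) ev)
      (NGet a_head (NGet a_stack (var a_top))) = nmem st a_head i.
    by rewrite -ei.
  set st1 := set_nat _ _ _ _.
  apply: (@examine_spec _ _ s l (rev (out_edges i))).
  + rewrite targetsE; split=> //; first by split=> // k' kl; rewrite [LHS]stk ?map_rcons ?nth_rcons ?size_map ?kl //; exact: leqW.
    by split=> // j jl; apply: l1; rewrite mem_rcons inE jl orbT.
  + exact: uniq_targets.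
  + by case: lk => _ _; apply.
  + by rewrite targetsE /funded; move: f => /=; lia.
- move=> st' k' [s' [l' [r' f']]] /=; rewrite -eqn0Ngt => /eqP t0.
  exists s'; case: l' {f'} r' => // i l' [_ _ [top _] _ _].
  by rewrite t0 in top.
Qed.

End Worklist.

(** * Initialisation and output *)

(** The query table holds q(i) + 1 on Q, whence the decrement; all queried nodes agree, so
    overwriting is harmless. *)
Definition find_colour :=
  for_loop a_i (NGet a_dim (NConst 0))
    (If (NEq (NGet a_query (var a_i)) (NConst 0)) Skip
        (NSet a_zero (NConst 0) (decr (NGet a_query (var a_i))))).

Definition link_edges :=
  for_loop a_i (NGet a_dim (NConst 1))
    (Seq (NSet a_next (var a_i) (NGet a_head (NGet a_src (var a_i))))
    (Seq (NSet a_head (NGet a_src (var a_i)) (NAdd (var a_i) (NConst 1)))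
         (add_to q_inw (NGet a_tgt (var a_i)) (QGet q_weight (var a_i))))).

(** The address 2i + x in a table with two columns, formed by additions only. [cell0] and [cell1]
    perform the renaming by addressing the original names of colours 0 and 1. *)
Definition cell x := NAdd (NAdd (var a_i) (var a_i)) x.
Definition cell0 := cell (var a_zero).
Definition cell1 := cell (NSub (NConst 1) (var a_zero)).
Definition set_col k := NSet a_col (var a_i) (NConst k).
Definition inw_i := QGet q_inw (var a_i).

(** Renaming, pruning and the initial strategy in one pass: the first rational comparison detects
    that colour 0 is deleted, the second that colour 1 is. *)
Definition init_colour :=
  If (NEq (NGet a_mem cell0) (NConst 1))
    (If (NEq (NGet a_mem cell1) (NConst 1))
       (If (QLt (QAdd (QGet q_bonus cell0) inw_i) (QGet q_bonus cell1)) (set_col 1)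
          (If (QLt (QAdd (QGet q_bonus cell1) inw_i) (QGet q_bonus cell0)) (set_col 2)
             (set_col 0)))
       (set_col 2))
    (set_col 1).

Definition init_nodes :=
  for_loop a_i (NGet a_dim (NConst 0))
    (Seq init_colour
    (Seq (QSet q_gap (var a_i) (QSub (QSub (QGet q_bonus cell1) (QGet q_bonus cell0)) inw_i))
         (If (NEq (NGet a_col (var a_i)) (NConst 1)) (push (var a_i)) Skip))).

Definition init_gaps :=
  for_loop a_i (NGet a_dim (NConst 1))
    (If (NEq (NGet a_col (NGet a_src (var a_i))) (NConst 1))
       (add_to q_gap (NGet a_tgt (var a_i)) (twice_weight (var a_i))) Skip).

Definition answer :=
  Seq (NSet a_out (NConst 0) (NConst 1))
    (for_loop a_i (NGet a_dim (NConst 0))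
       (If (NEq (NGet a_query (var a_i)) (NConst 0)) Skip
          (If (NEq (NGet a_col (var a_i)) (NConst 1)) (NSet a_out (NConst 0) (NConst 0)) Skip))).

Definition algorithm_A :=
  Seq find_colour (Seq link_edges (Seq init_nodes (Seq init_gaps (Seq worklist answer)))).

Lemma nth_allpairs (S T U : Type) (f : S -> T -> U) (s : seq S) (t : seq T) x0 y0 z0 i j :
  i < size s -> j < size t ->
  nth z0 [seq f x y | x <- s, y <- t] (i * size t + j) = f (nth x0 s i) (nth y0 t j).
Proof.
elim: s i => //= x s IH [|i] is_ js; rewrite nth_cat size_map.
  by rewrite mul0n add0n js (nth_map y0).
by rewrite mulSn -addnA ltnNge leq_addr /= addKn IH.
Qed.

(** Pointers strictly decrease along a chain, so only cells below the head pointer are read. *)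
Lemma chain_ext n (H : game n 'I_2) tgt next next' w p l :
  (forall e, e < p -> next' e = next e) ->
  chain H tgt next w p l -> chain H tgt next' w p l.
Proof.
elim: l p => //= x l IH p eqn [e [pE te we le c]]; exists e.
have ne : next' e = next e by apply: eqn; rewrite pE.
split; rewrite ?ne //; apply: IH c => e' e'lt; apply: eqn.
by rewrite pE; apply: leq_trans e'lt (leqW _).
Qed.

(** No colour dominates itself, as the in-weight is nonnegative; with two colours only the other one
    remains as a candidate. *)
Lemma mem_prune2 n (K : game n 'I_2) i (x y : 'I_2) : well_formed K -> x != y ->
  (x \in colours (prune K) i) = (x \in colours K i) &&
    ~~ ((y \in colours K i) && ((bonus K i x)%:~R + inweight K i < (bonus K i y)%:~R)%R).
Proof.
move=> wfK xy; rewrite mem_prune; congr (_ && ~~ _).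
apply/exists_inP/andP => [[w wC wlt]|[yC ylt]]; last by exists y.
suff <- : w = y by [].
case: (eqVneq w x) => [wx|].
  by move: wlt; rewrite wx gtrDl ltNge inweight_ge0.
by move: xy; case: (ord2_cases w) => ->; case: (ord2_cases x) => ->; case: (ord2_cases y) => ->.
Qed.

(** * Specifications of the phases of the program *)

Section Machine.
Context (n : nat) (G : game n 'I_2) (q : query n 'I_2) (z : 'I_2) (x0 : 'I_n * 'I_n).
Context (es : seq ('I_n * 'I_n)).
Implicit Types (st : store) (s : strategy n 'I_2).

Let H := prune (recolour (tperm z 0%R) G).

Hypothesis wfG : well_formed G.
Hypothesis esE : perm_eq es (enum (edges G)).
Hypothesis qz : forall i x, q i = Some x -> x = z.
Hypothesis qN : exists i, q i != None.

Let Q (i : 'I_n) : nat := if q i is Some x then x.+1 else 0.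

(** It mentions only arrays that the program never writes, so it survives every phase. *)
Definition input st :=
  [/\ nmem st a_dim 0 = n, nmem st a_dim 1 = size es,
      forall k, k < size es -> [/\ nmem st a_src k = (nth x0 es k).1,
        nmem st a_tgt k = (nth x0 es k).2 &
        qmem st q_weight k = weight G (nth x0 es k).1 (nth x0 es k).2],
      forall (i : 'I_n) (x : 'I_2), nmem st a_mem (i + i + x) = (x \in colours G i) /\
        qmem st q_bonus (i + i + x) = (bonus G i x)%:~R%R &
      forall i : 'I_n, nmem st a_query i = Q i].

Lemma input_load : input (load G q es).
Proof.
split=> //=.
- move=> k kn; split; first by rewrite (nth_map x0).
    by rewrite (nth_map x0).
  by rewrite (nth_map x0).
- move=> i x; have -> : i + i + x = i * size (enum 'I_2) + x by rewrite size_enum_ord muln2 addnn.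
  have hi : i < size (enum 'I_n) by rewrite size_enum_ord.
  have hx : x < size (enum 'I_2) by rewrite size_enum_ord.
  by split; rewrite (nth_allpairs _ i x) // !nth_ord_enum.
- by move=> i; rewrite (nth_map i) ?size_enum_ord // nth_ord_enum.
Qed.

(** The initial zeros that serve as empty lists, empty stack and empty sums. *)
Definition blank st :=
  [/\ forall i, nmem st a_head i = 0, nmem st a_top 0 = 0, forall i, qmem st q_inw i = 0%R &
      tape st = [::]].

Lemma find_colour_spec :
  wp find_colour (fun st' _ => [/\ input st', blank st' & nmem st' a_zero 0 = z])
    (load G q es) (n * 60 + 60).
Proof.
apply: (@wp_for _ _ _ (fun x st => [/\ input st, blank st &
  nmem st a_zero 0 = z \/ nmem st a_zero 0 = 0 /\ forall i : 'I_n, i < x -> q i = None]) 40 n).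
- by move=> x st [[]].
- move=> x st xn [inp bl zc] ix.
  have [_ _ _ _ iq] := inp; have := iq (Ordinal xn); rewrite /= => qx.
  apply: wp_if => //= qe.
  + apply: wp_skip => //; split=> //; split=> //.
    case: zc => [ez|[ez eq]]; [left|right] => //; split=> // i.
    rewrite ltnS leq_eqVlt => /orP[/eqP ixe|]; last exact: eq.
    move: qe; rewrite ix -ixe iq /Q; case: (q i) => //.
  + apply: wp_nset => //=; split=> //; split=> //; left.
    move: qe; rewrite ix /= /update /= qx /Q; case E: (q _) => [y|] // _.
    by rewrite subn1 (qz E).
- split; [exact: input_load | by split=> //= i; case: i | by right; split].
- by move=> /=; lia.
- move=> st k [inp bl zc] _; split=> //.
  case: zc => // -[_ qn]; case: qN => i; by rewrite qn.
Qed.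


Local Notation inw_upto x i :=
  (\sum_(p <- take x es | p.2 == i) weight G p.1 p.2)%R (only parsing).

(** The bound on [a_head] keeps cell [x] of [a_next] outside all chains built so far, so prepending
    edge [x] leaves them intact. *)
Definition linked_upto x st := forall i : 'I_n,
  [/\ chain H (nmem st a_tgt) (nmem st a_next) (qmem st q_weight) (nmem st a_head i)
        (rev (out_edges (take x es) i)),
      nmem st a_head i <= x & qmem st q_inw i = inw_upto x i].

Lemma link_edges_spec st : input st -> blank st -> nmem st a_zero 0 = z ->
  wp link_edges (fun st' _ => [/\ input st', nmem st' a_zero 0 = z, nmem st' a_top 0 = 0,
    tape st' = [::] & linked_upto (size es) st']) st (size es * 60 + 60).
Proof.
move=> inp [h0 t0 w0 tp] ez.
apply: (@wp_for _ _ _ (fun x st' => [/\ input st', nmem st' a_zero 0 = z, nmem st' a_top 0 = 0,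
    tape st' = [::] & linked_upto x st']) 40 (size es)).
- by move=> x st' [[]].
- move=> {inp h0 t0 w0 tp ez} x {}st xn [inp ez t0 tp lk] ix.
  have [_ _ /(_ _ xn)[sx tx wx] _ _] := inp.
  set p := nth x0 es x in sx tx wx.
  have tE : take x.+1 es = rcons (take x es) p by rewrite (take_nth x0).
  do 2!(apply: wp_seq; apply: wp_nset => //=).
  apply: wp_qset => //=; split=> //; split=> //.
  move=> i; have [c le w] := lk i; rewrite tE /out_edges filter_rcons big_rcons /=.
  have [cp lep wp] := lk p.1.
  have cn j : nmem st a_head j <= x -> forall l,
    chain H (nmem st a_tgt) (nmem st a_next) (qmem st q_weight) (nmem st a_head j) l ->
    chain H (nmem st a_tgt) (update (nmem st) a_next x (nmem st a_head p.1) a_next)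
      (qmem st q_weight) (nmem st a_head j) l.
    move=> jx l; apply: chain_ext => e ej; rewrite /update /=.
    by case: eqP => // ex; move: (leq_trans ej jx); rewrite ex ltnn.
  rewrite /update /= ix sx tx wx.
  rewrite -[_ == _ :> nat]/(i == p.1) -[(i : nat) == p.2]/(i == p.2).
  split.
  + case: (eqVneq p.1 i) => [<-|_] /=; last exact: cn.
    rewrite rev_rcons /=; exists x; rewrite eqxx; split=> //; rewrite ?addn1 //.
    exact: cn.
  + by case: ifP => // _; [rewrite addn1 | exact: leqW].
  + case: (eqVneq p.2 i) => [pi|_] /=; last by rewrite addr0.
    by rewrite pi w.
- split=> // i; split; rewrite ?take0 ?big_nil //=; first by exact: h0.
    exact: eq_leq (h0 i).
- by move=> /=; lia.
- by [].
Qed.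


(** The original name of colour 1. *)
Let other : 'I_2 := ((tperm z 0%R)^-1)%g 1%R.

Let otherE : other = 1 - z :> nat.
Proof. by rewrite /other tpermV; case: (ord2_cases z) => ->; rewrite ?tperm1 ?perm1 ?tpermL. Qed.

Let other_neq : z != other.
Proof. by rewrite -val_eqE /= otherE; case: (ord2_cases z) => ->. Qed.

Let wfK : well_formed (recolour (tperm z 0%R) G).
Proof. exact: well_formed_recolour. Qed.

Let wfH : well_formed H.
Proof. exact: well_formed_prune. Qed.

Let bonus0 i : bonus H i 0%R = bonus G i z.
Proof. by rewrite /= tpermV tpermR. Qed.

Lemma mem_H0 i : (0%R \in colours H i) = (z \in colours G i) &&
    ~~ ((other \in colours G i) && ((bonus G i z)%:~R + inweight G i < (bonus G i other)%:~R)%R).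
Proof.
rewrite (@mem_prune2 _ _ _ _ 1%R) // !mem_recolour -/other.
by rewrite -[bonus _ i 0%R]/(bonus H i 0%R) bonus0 tpermV tpermR.
Qed.

Lemma mem_H1 i : (1%R \in colours H i) = (other \in colours G i) &&
    ~~ ((z \in colours G i) && ((bonus G i other)%:~R + inweight G i < (bonus G i z)%:~R)%R).
Proof.
rewrite (@mem_prune2 _ _ _ _ 0%R) // !mem_recolour -/other.
by rewrite -[bonus _ i 0%R]/(bonus H i 0%R) bonus0 tpermV tpermR.
Qed.

Let s0 := strat (initial H).

Lemma s0_eq1 i : (s0 i == 1%R) = (0%R \notin colours H i).
Proof. by rewrite ffunE; case: (_ \in _). Qed.

Lemma init_colour_spec st (i : 'I_n) : input st -> nmem st a_zero 0 = z ->
  qmem st q_inw i = inweight G i -> nmem st a_i 0 = i ->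
  wp init_colour (fun st' _ => st' = set_nat st a_col i (colour_code H s0 i)) st 120.
Proof.
move=> [_ _ _ tab _] ez ew ei.
have [m0 b0] := tab i z; have [m1 b1] := tab i other.
have e0 : neval st cell0 = i + i + z by rewrite /= ei ez.
have e1 : neval st cell1 = i + i + other by rewrite /= ei ez otherE.
have ewi : qeval st inw_i = inweight G i by rewrite /= ei ew.
have t0 : teval st (NEq (NGet a_mem cell0) (NConst 1)) = (z \in colours G i).
  by rewrite /teval [neval _ _](_ : _ = nmem st a_mem (neval st cell0)) // e0 m0; case: (_ \in _).
have t1 : teval st (NEq (NGet a_mem cell1) (NConst 1)) = (other \in colours G i).
  by rewrite /teval [neval _ _](_ : _ = nmem st a_mem (neval st cell1)) // e1 m1; case: (_ \in _).
have t01 : teval st (QLt (QAdd (QGet q_bonus cell0) inw_i) (QGet q_bonus cell1)) =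
    ((bonus G i z)%:~R + inweight G i < (bonus G i other)%:~R)%R.
  by move: b0 b1 ewi; rewrite -e0 -e1 => <- <- <-.
have t10 : teval st (QLt (QAdd (QGet q_bonus cell1) inw_i) (QGet q_bonus cell0)) =
    ((bonus G i other)%:~R + inweight G i < (bonus G i z)%:~R)%R.
  by move: b0 b1 ewi; rewrite -e0 -e1 => <- <- <-.
have set_colE k m : 10 <= k -> wp (set_col m) (fun st' _ => st' = set_nat st a_col i m) st k.
  by move=> k10; apply: wp_nset; rewrite /= ?ei //; lia.
rewrite /colour_code s0_eq1 mem_H0 mem_H1.
apply: wp_if => //; rewrite t0; case: (z \in _) => //= _; last exact: set_colE.
apply: wp_if => //; rewrite t1; case: (other \in _) => //= _; last exact: set_colE.
apply: wp_if => //; rewrite t01 negbK; first by (move=> ->; apply: set_colE).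
move=> /negbTE ->.
by apply: wp_if => //; rewrite t10; [move=> -> | move=> /negbTE ->]; apply: set_colE.
Qed.


(** The gap when no in-neighbour has colour 1; [init_gaps] corrects it once all initial colours are
    known. *)
Definition base_gap i : rat :=
  ((bonus G i other)%:~R - (bonus G i z)%:~R - inweight G i)%R.

Let linked := linked H es Q.

Definition nodes_upto x st := exists l, [/\ stacked st l, uniq l,
  forall i : 'I_n, (i \in l) = (i < x) && (s0 i == 1%R) &
  forall i : 'I_n, i < x -> nmem st a_col i = colour_code H s0 i /\ qmem st q_gap i = base_gap i].

Lemma init_nodes_spec st : input st -> nmem st a_zero 0 = z -> nmem st a_top 0 = 0 ->
  tape st = [::] -> linked st -> (forall i : 'I_n, qmem st q_inw i = inweight G i) ->
  wp init_nodes (fun st' _ => [/\ input st', tape st' = [::], linked st' & nodes_upto n st'])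
    st (n * 240 + 60).
Proof.
move=> inp ez t0 tp lk wE.
apply: (@wp_for _ _ _ (fun x st' => [/\ input st', nmem st' a_zero 0 = z /\ tape st' = [::],
  linked st', forall i : 'I_n, qmem st' q_inw i = inweight G i & nodes_upto x st']) 220 n).
- by move=> x st' [[]].
- move=> {inp ez t0 tp lk wE} x {}st xn [inp [ez tp] lk wE [l [[top stk] ul lE colE]]].
  have [i xi] : exists i : 'I_n, x = i by exists (Ordinal xn).
  subst x => ei.
  apply: wp_seq; apply: wp_frame (init_colour_spec inp ez (wE i) ei) _ _ => // st1 k1 -> k1le.
  have [_ _ _ tab _] := inp; have [_ b0] := tab i z; have [_ b1] := tab i other.
  have le_cases (j : 'I_n) : j < i.+1 -> j != i -> j < i.
    by rewrite ltnS leq_eqVlt => /orP[/eqP/val_inj ->|//]; rewrite eqxx.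
  apply: wp_seq; apply: wp_qset => /=; first by lia.
  set st2 := set_rat _ _ _ _.
  have col2 (j : 'I_n) : j < i.+1 ->
      nmem st2 a_col j = colour_code H s0 j /\ qmem st2 q_gap j = base_gap j.
    move=> ji; rewrite /st2 /= /update /= ei ez -otherE b0 b1 wE.
    rewrite -[_ == _ :> nat]/(j == i); case: (eqVneq j i) => [->//|jn].
    exact/colE/le_cases.
  have i2 : nmem st2 a_i 0 = i by exact: ei.
  have in2 : input st2 by exact: inp.
  have lk2 : linked st2 by exact: lk.
  have w2 : forall i : 'I_n, qmem st2 q_inw i = inweight G i by exact: wE.
  have top2 : nmem st2 a_top 0 = size l by exact: top.
  have stk2 k : k < size l -> nmem st2 a_stack k = nth 0 (map val l) k by exact: stk.
  have zt2 : nmem st2 a_zero 0 = z /\ tape st2 = [::] by split; [exact: ez | exact: tp].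
  have [c2 _] := col2 i (ltnSn i).
  clearbody st2.
  have code1 : (colour_code H s0 i == 1) = (s0 i == 1%R).
    by rewrite /colour_code; case: (s0 i == 1%R) => //; case: ifP.
  have il : i \notin l by rewrite lE ltnn.
  have lSE (j : 'I_n) : (j < i.+1) && (s0 j == 1%R) =
      ((j == i) && (s0 i == 1%R)) || (j \in l).
    rewrite lE ltnS leq_eqVlt -[_ == _ :> nat]/(j == i).
    by case: (eqVneq j i) => [->|_] //=; rewrite ltnn orbF.
  apply: wp_if => /=; first by lia.
  + rewrite i2 c2 code1 => s1.
    apply: wp_seq; apply: wp_nset => /=; first by lia.
    apply: wp_nset => /=; first by lia.
    split=> //; split=> //.
    exists (rcons l i); split.
    * split; first by rewrite /= /update /= top2 size_rcons addn1.
      move=> k; rewrite size_rcons ltnS => kl.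
      rewrite /= /update /= top2 i2 map_rcons nth_rcons size_map.
      by case: ltngtP kl => // kl _; apply: stk2.
    * by rewrite rcons_uniq il.
    * by move=> j; rewrite lSE s1 andbT mem_rcons inE.
    * exact: col2.
  + rewrite i2 c2 code1 => s1; apply: wp_skip; first by lia.
    split=> //; split=> //; exists l; split=> // j.
    by rewrite lSE (negbTE s1) andbF.
- split=> //; exists [::]; split=> //.
- by move=> /=; lia.
- by move=> st' k' [inp' [_ tp'] lk' _ nd'] _.
Qed.

Definition gaps_upto x st := forall i : 'I_n, qmem st q_gap i =
  (base_gap i + \sum_(p <- take x es | (p.2 == i) && (s0 p.1 == 1))
     (weight G p.1 p.2 + weight G p.1 p.2))%R.

Lemma init_gaps_spec st (l : seq 'I_n) : input st -> tape st = [::] -> linked st -> stacked st l ->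
  coloured H st s0 -> (forall i : 'I_n, qmem st q_gap i = base_gap i) ->
  wp init_gaps (fun st' _ => [/\ tape st' = [::], linked st', stacked st' l, coloured H st' s0 &
     gaps_upto (size es) st']) st (size es * 60 + 60).
Proof.
move=> inp tp lk sk cl gp.
apply: (@wp_for _ _ _ (fun x st' => [/\ input st' /\ tape st' = [::], linked st',
   stacked st' l, coloured H st' s0 & gaps_upto x st']) 40 (size es)).
- by move=> x st' [[[]]].
- move=> {inp tp lk sk cl gp} x {}st xn [[inp tp] lk sk cl gp] ix.
  have [_ _ /(_ _ xn)[sx tx wx] _ _] := inp.
  set p := nth x0 es x in sx tx wx.
  have tE : take x.+1 es = rcons (take x es) p by rewrite (take_nth x0).
  have code1 : (colour_code H s0 p.1 == 1) = (s0 p.1 == 1%R).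
    by rewrite /colour_code; case: (s0 _ == 1%R) => //; case: ifP.
  apply: wp_if => //=; rewrite ix sx cl code1 => s1.
  + apply: wp_qset => //=; split=> //; split=> // i.
    rewrite /= /update /= ix tx wx tE big_rcons /= s1 andbT.
    rewrite -[(i : nat) == p.2]/(i == p.2).
    case: (eqVneq p.2 i) => [->|_] /=; last by rewrite addr0 gp.
    by rewrite gp -addrA.
  + apply: wp_skip => //; split=> //; split=> // i.
    by rewrite tE big_rcons /= (negbTE s1) andbF addr0; exact: gp.
- by split=> // i; rewrite take0 big_nil addr0; exact: gp.
- by move=> /=; lia.
- by move=> st' k' [[]].
Qed.

Lemma answer_spec st s : linked st -> coloured H st s ->
  wp answer (fun st' _ => tape st' = tape st /\
     outputs_yes st' = [forall i, (q i != None) ==> (s i == 0%R)]) st (n * 60 + 60).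
Proof.
move=> lk cl; apply: wp_seq; apply: wp_nset => /=; first by lia.
set st1 := set_nat _ _ _ _.
apply: (@wp_for _ _ _ (fun x st' => [/\ linked st', coloured H st' s, tape st' = tape st &
  nmem st' a_out 0 = [forall i : 'I_n, (i < x) && (q i != None) ==> (s i == 0%R)]]) 40 n).
- by move=> x st' [[]].
- move=> {lk cl} x st2 xn [lk cl tp oE].
  have [_ qE _] := lk.
  have [i xi] : exists i : 'I_n, x = i by exists (Ordinal xn).
  subst x => ix.
  have fE : [forall j : 'I_n, (j < i.+1) && (q j != None) ==> (s j == 0%R)] =
     ((q i != None) ==> (s i == 0%R)) && [forall j : 'I_n, (j < i) && (q j != None) ==> (s j == 0%R)].
    apply/forallP/andP => [h|[hi /forallP h] j].
      split; first by have := h i; rewrite ltnSn.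
      by apply/forallP => j; apply/implyP => /andP[ji qj]; have := h j; rewrite ltnS (ltnW ji) qj.
    rewrite ltnS leq_eqVlt -[_ == _ :> nat]/(j == i).
    by case: (eqVneq j i) => [->|_] //; exact: h.
  have q0 : (Q i == 0) = (q i == None) by rewrite /Q; case: (q i).
  have code1 : (colour_code H s i == 1) = (s i != 0%R).
    by rewrite -ord2_eq1 /colour_code; case: (s _ == 1%R) => //; case: ifP.
  apply: wp_if => //=; rewrite ix qE q0 => qi.
    by apply: wp_skip => //; split=> //; split=> //; rewrite fE qi.
  apply: wp_if => //=; rewrite ix cl code1 => si.
    apply: wp_nset => //=; split=> //; split=> //.
    by rewrite /= /update /= fE qi (negbTE si).
  apply: wp_skip => //; split=> //; split=> //.
  by rewrite fE; move: si; rewrite negbK => ->; rewrite implybT.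
- split=> //; rewrite (_ : [forall i, _] = true) //.
  by apply/forallP => i; rewrite ltn0.
- by move: st1 => st1 /=; lia.
- move=> st' k' [_ _ tp oE] _; split=> //.
  rewrite /outputs_yes oE eqb1; apply: eq_forallb => i.
  by rewrite ltn_ord.
Qed.


(** Renaming and pruning keep the edges, so the two sets are convertible. *)
Let esH : perm_eq es (enum (edges H)).
Proof. exact: esE. Qed.

Let gsizeE : gsize G = n * 2 + size es.
Proof. by rewrite /gsize card_ord (perm_size esE) -cardE. Qed.

(** Outside the worklist the phases take at most 360 operations per node, 120 per edge and 300
    more. *)
Lemma algorithm_A_spec :
  wp algorithm_A (fun st _ => exists k, [/\ run H (tape st) k, terminal k &
    outputs_yes st = [forall i, (q i != None) ==> (strat k i == 0%R)]])
    (load G q es) (1000 * gsize G).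
Proof.
(* A positive number of nodes lets [gsize] absorb the additive constants. *)
have n_gt0 : 0 < n by case: (x0.1) => m; apply: leq_ltn_trans.
have szE := gsizeE.
apply: wp_seq; apply: wp_frame find_colour_spec _ _ => [|st1 k1 [in1 bl1 z1] k1le].
  by rewrite szE; lia.
apply: wp_seq; apply: wp_frame (link_edges_spec in1 bl1 z1) _ _ => [|st2 k2 [in2 z2 t2 tp2 up2] k2le].
  by lia.
have lk2 : linked st2.
  have [n2 _ _ _ q2] := in2; split=> // i.
  by have [] := up2 i; rewrite take_size.
have w2 (i : 'I_n) : qmem st2 q_inw i = inweight G i.
  have [_ _ ->] := up2 i; rewrite take_size.
  exact: (sum_es_inweight esE).
apply: wp_seq; apply: wp_frame (init_nodes_spec in2 z2 t2 tp2 lk2 w2) _ _ => [|st3 k3].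
  by lia.
move=> [in3 tp3 lk3 [l [sk3 ul lE cg3]]] k3le.
have cl3 : coloured H st3 s0 by move=> i; have [] := cg3 i (ltn_ord i).
have gp3 (i : 'I_n) : qmem st3 q_gap i = base_gap i by have [] := cg3 i (ltn_ord i).
apply: wp_seq; apply: wp_frame (init_gaps_spec in3 tp3 lk3 sk3 cl3 gp3) _ _ => [|st4 k4].
  by lia.
move=> [tp4 lk4 sk4 cl4 gp4] k4le.
have initE : initial H = Config s0 [set i in l] set0.
  by congr (Config _ _ _); apply/setP => i; rewrite !inE lE ltn_ord.
have rep4 : rep H es Q st4 s0 l set0.
  split=> // [i|].
    by rewrite gp4 take_size /gap (sum_es_inweight esH) bonus0 /base_gap.
  split=> // [i|]; first by rewrite lE => /andP[_ /eqP].
  by rewrite /run tp4 -initE; apply: StepsNil.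
have := potential_initial H; rewrite initE -[gsize H]/(gsize G) => pot.
(* The initial potential is at most [2 * gsize G], at 100 operations per unit, plus the reserve
   20. *)
apply: wp_seq; apply: (@wp_frame _ _ _ _ (200 * gsize G + 20)).
- by apply: (worklist_spec wfH esH rep4); rewrite /funded; lia.
- by lia.
move=> st5 k5 [s5 [lk5 cl5 sk5 gp5 [_ _ run5]]] k5le.
apply: wp_frame (answer_spec lk5 cl5) _ _ => [|st6 k6 [tp6 out6] _]; first by lia.
exists (Config s5 set0 set0); split; rewrite ?out6 // /terminal ?eqxx // tp6.
by move: run5; congr (run _ _ (Config _ _ _)); apply/setP => i; rewrite !inE.
Qed.

End Machine.

Theorem theorem1 :
  exists (P : prog) (c : nat),
  forall (n : nat) (G : game n 'I_2) (q : query n 'I_2),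
    (1 < n)%N -> well_formed G -> is_query G q -> monochromatic q ->
    let G0 := prune (recolour (to_zero q) G) in
    let q0 := recolour_query (to_zero q) q in
    [/\ forall (tr : seq event) (k : config n),
          run G0 tr k -> (size tr <= c * gsize G)%N,
        forall (tr : seq event) (k : config n),
          run G0 tr k -> terminal k -> (answers_yes q0 k <-> exists_NE G q) &
        forall es : seq ('I_n * 'I_n), perm_eq es (enum (edges G)) ->
          exists (st : store) (t : nat),
          [/\ exec P (load G q es) st t,
              (t <= c * gsize G)%N,
              outputs_yes st <-> exists_NE G q &
              exists k : config n,
                [/\ run G0 (tape st) k, terminal k &
                    outputs_yes st = answers_yes q0 k]]].
Proof.
exists algorithm_A, 1000 => n G q n_gt1 wfG [[i0 qi0] _] mono G0 q0.
have wfK := well_formed_recolour (to_zero q) wfG.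
have wfG0 : well_formed G0 by exact: well_formed_prune.
(* The default in [to_zero] never applies, because some node is queried. *)
have [z zE qz] : exists2 z, to_zero q = tperm z 0%R & forall i x, q i = Some x -> x = z.
  rewrite /to_zero; case: pickP => [z /existsP[i /eqP qi]|none].
    by exists z => // j x qj; apply: mono qj qi.
  case qi: (q i0) qi0 => [x|] // _.
  by have /existsP[] := none x; exists i0; rewrite qi.
have q0z : zero_query q0.
  move=> i x; rewrite ffunE; case qi: (q i) => [y|] //= [<-].
  by rewrite zE (qz _ _ qi) tpermL.
have pr : pruned G0.
  move=> j; rewrite !mem_prune => /andP[_ /exists_inPn nlt] /andP[C1 _].
  by rewrite leNgt; apply: nlt.
have yesP tr k : run G0 tr k -> terminal k -> (answers_yes q0 k <-> exists_NE G q).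
  move=> rk tk; apply: iff_trans (answers_yesP wfG0 pr q0z rk tk) _.
  apply: iff_trans (exists_NE_prune _ wfK) _.
  by apply: iff_sym; apply: exists_NE_recolour.
split=> // [tr k rk|es esE].
  by apply: leq_trans (size_run rk) _; rewrite leq_mul2r orbT.
have qN : exists i, q i != None by exists i0.
(* The pair [(i0, i0)] only serves as the default of [nth] and need not be an edge. *)
have [] := algorithm_A_spec (z := z) (i0, i0) wfG esE qz qN.
move=> st [t [ex tle [k]]]; rewrite -zE => -[rk tk out].
have outE : outputs_yes st = answers_yes q0 k.
  (* Renaming a query keeps its domain, and the answer looks at nothing else of the query. *)
  by rewrite out; apply: eq_forallb => i; rewrite ffunE; case: (q i).
exists st, t; split=> //; last by exists k.
by rewrite outE; apply: yesP rk tk.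
Qed.
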